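(* Let $\mathrm{M}$ be a loopless matroid of rank $r+1$ on $E$, let $\mathscr{P}_-$ be an order filter of nonempty proper flats, let $Z$ be a flat maximal among nonempty proper flats not in $\mathscr{P}_-$, and put $\mathscr{P}_+=\mathscr{P}_-\cup\{Z\}$. For every positive integer $q$, the homomorphism $$\Phi_Z^q\oplus\bigoplus_{p=1}^{\mathrm{rk}(Z)-1}\Psi_Z^{p,q}: A^q(\mathrm{M},\mathscr{P}_-)\oplus\bigoplus_{p=1}^{\mathrm{rk}(Z)-1}A^{q-p}(\mathrm{M}_Z)\longrightarrow A^q(\mathrm{M},\mathscr{P}_+)$$ is an isomorphism.
   Context: An order filter is a set $\mathscr{P}$ of nonempty proper flats with $F_1\subseteq F_2$, $F_1\in\mathscr{P}\Rightarrow F_2\in\mathscr{P}$. For an order filter $\mathscr{P}$, $A^*(\mathrm{M},\mathscr{P})$ is the graded ring $\mathbb{Z}[x_i,x_F: i\in E, F\in\mathscr{P}]$ modulo the ideal generated by: $x_{F_1}x_{F_2}$ for incomparable $F_1,F_2\in\mathscr P$; $x_ix_F$ for $F\in\mathscr{P}$, $i\in E\setminus F$; $\prod_{i\in I}x_i$ for independent sets $I$ whose closure lies in $\mathscr{P}\cup\{E\}$; and $(x_i+\sum_{F\in\mathscr{P},i\in F}x_F)-(x_j+\sum_{F\in\mathscr{P},j\in F}x_F)$ for distinct $i,j\in E$. For a loopless matroid $\mathrm{N}$, $A^*(\mathrm{N})$ denotes $\mathbb{Z}[x_F: F$ nonempty proper flat of $\mathrm{N}]$ modulo $x_{F_1}x_{F_2}$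 for incomparable $F_1,F_2$ and $\sum_{F\ni i_1}x_F-\sum_{F\ni i_2}x_F$ for distinct elements $i_1,i_2$. $\mathrm{M}_Z$ is the contraction of $\mathrm{M}$ by $Z$, a loopless matroid on $E\setminus Z$ of rank $\mathrm{crk}_\mathrm{M}(Z)$, whose nonempty proper flats are identified with the flats $F$ of $\mathrm{M}$ with $Z\subsetneq F\subsetneq E$. $\Phi_Z:A^*(\mathrm{M},\mathscr{P}_-)\to A^*(\mathrm{M},\mathscr{P}_+)$ is the (well-defined) graded ring homomorphism with $x_F\mapsto x_F$, $x_i\mapsto x_i+x_Z$ if $i\in Z$ and $x_i\mapsto x_i$ if $i\notin Z$; $\Phi^q_Z$ is its degree $q$ part. For positive integers $p,q$, $\Psi_Z^{p,q}:A^{q-p}(\mathrm{M}_Z)\to A^q(\mathrm{M},\mathscr{P}_+)$ is the (well-defined) group homomorphism sending $x_{F_1}\cdots x_{F_{q-p}}\mapsto x_Z^p x_{F_1}\cdots x_{F_{q-p}}$ for chains $F_1\subsetneq\cdots$ of nonempty proper flats of $\mathrm{M}_Z$ (such monomials generate $A^{q-p}(\mathrm{M}_Z)$). *)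

(* Defs.v *)
From HB Require Import structures.
From mathcomp Require Import all_boot all_order all_algebra.
From mathcomp Require Import boolp mpoly.

Set Implicit Arguments.
Unset Strict Implicit.
Unset Printing Implicit Defensive.

Import GRing.Theory Quotient.

Local Open Scope ring_scope.
Local Open Scope quotient_scope.

(* A matroid is given by its rank function. *)
Record matroid (E : finType) := Matroid {
  mrank :> {set E} -> nat;
  mrank_card : forall A, (mrank A <= #|A|)%N;
  mrank_mono : forall A B : {set E}, A \subset B -> (mrank A <= mrank B)%N;
  mrank_submod : forall A B : {set E},
    (mrank (A :|: B) + mrank (A :&: B) <= mrank A + mrank B)%N }.

Section Matroid.
Variables (E : finType) (M : matroid E).
Implicit Types (A B F I : {set E}) (P : {set {set E}}).

Definition indep I : bool := M I == #|I|.
Definition closure A : {set E} := [set e | M (e |: A) == M A].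
Definition flat F : bool := closure F == F.
Definition loopless : Prop := forall e, indep [set e].

(* The nonempty proper flats. *)
Definition pflats : {set {set E}} :=
  [set F | [&& flat F, F != set0 & F != [set: E]]].

Definition order_filter P : Prop :=
  P \subset pflats /\
  forall F1 F2, F1 \in P -> F2 \in pflats -> F1 \subset F2 -> F2 \in P.

Lemma sub_closure A : A \subset closure A.
Proof. by apply/subsetP=> e eA; rewrite inE (setUidPr _) ?sub1set. Qed.

Lemma flatP F : reflect (forall e, M (e |: F) = M F -> e \in F) (flat F).
Proof.
apply: (iffP eqP) => [clF e eF|clF]; first by rewrite -clF inE eF.
apply/eqP; rewrite eqEsubset sub_closure andbT.
by apply/subsetP=> e; rewrite inE => /eqP /clF.
Qed.

Lemma mrank_setU A B : (M (A :|: B) <= M A + M B)%N.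
Proof. exact: leq_trans (leq_addr _ _) (mrank_submod _ _ _). Qed.

Lemma closure_mono A B : A \subset B -> closure A \subset closure B.
Proof.
move=> AB; apply/subsetP=> e; rewrite !inE => /eqP eA.
rewrite eqn_leq; apply/andP; split; last exact: mrank_mono (subsetUr _ _).
have := mrank_submod M (e |: A) B; rewrite -setUA (setUidPr AB) eA => le1.
rewrite -(leq_add2r (M A)) [leqRHS]addnC; apply: leq_trans le1.
by rewrite leq_add2l; apply: mrank_mono; rewrite subsetI subsetUr.
Qed.

End Matroid.

Section Contraction.
Variables (E : finType) (M : matroid E) (Z : {set E}).
Let EZ : finType := {e : E | e \notin Z}.
Implicit Types A B G : {set EZ}.

(* A flat G of the contraction corresponds to the flat of M that is the
   union of G and Z. *)
Definition zlift G : {set E} := [set val e | e in G] :|: Z.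

Definition contract_rank G : nat := (M (zlift G) - M Z)%N.

Lemma zlift_mem G e : (val e \in zlift G) = (e \in G).
Proof.
rewrite inE (negbTE (valP e)) orbF.
by apply: mem_imset; exact: val_inj.
Qed.

Lemma sub_zlift G : Z \subset zlift G. Proof. exact: subsetUr. Qed.

Lemma zliftU A B : zlift (A :|: B) = zlift A :|: zlift B.
Proof. by rewrite /zlift imsetU -setUUl. Qed.

Lemma zliftI A B : zlift (A :&: B) = zlift A :&: zlift B.
Proof. by rewrite /zlift imsetI -?setUIl // => x y _ _; apply: val_inj. Qed.

Lemma zliftS A B : (zlift A \subset zlift B) = (A \subset B).
Proof.
apply/idP/idP=> [/subsetP AB|AB]; last by rewrite setSU // imsetS.
by apply/subsetP=> e; rewrite -!zlift_mem => /AB.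
Qed.

Lemma zlift_inj : injective zlift.
Proof. by move=> A B AB; apply/eqP; rewrite eqEsubset -!zliftS AB subxx. Qed.

Lemma zlift1U e A : zlift (e |: A) = val e |: zlift A.
Proof. by rewrite /zlift imsetU1 setUA. Qed.

Lemma rank_zlift A : (M Z <= M (zlift A))%N.
Proof. exact: mrank_mono (sub_zlift A). Qed.

Fact contract_rank_card A : (contract_rank A <= #|A|)%N.
Proof.
rewrite leq_subLR addnC; apply: leq_trans (mrank_setU M _ _) _.
rewrite leq_add2r; apply: leq_trans (mrank_card _ _) _.
exact: leq_imset_card.
Qed.

Fact contract_rank_mono A B :
  A \subset B -> (contract_rank A <= contract_rank B)%N.
Proof. by move=> AB; rewrite leq_sub2r // mrank_mono // zliftS. Qed.

Fact contract_rank_submod A B :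
  (contract_rank (A :|: B) + contract_rank (A :&: B)
     <= contract_rank A + contract_rank B)%N.
Proof.
rewrite -(leq_add2r (M Z + M Z)) [leqLHS]addnACA [leqRHS]addnACA.
by rewrite /contract_rank !subnK ?rank_zlift // zliftU zliftI mrank_submod.
Qed.

Definition contract : matroid EZ :=
  Matroid contract_rank_card contract_rank_mono contract_rank_submod.

Lemma flat_contract G : flat contract G = flat M (zlift G).
Proof.
apply/flatP/flatP=> clG e.
  have [eZ _|eZ] := boolP (e \in Z); first exact: (subsetP (sub_zlift G)).
  have -> : e = val (exist (fun e => e \notin Z) e eZ) by [].
  by rewrite zlift_mem -zlift1U => eG; apply: clG; rewrite /= /contract_rank eG.
rewrite -zlift_mem => eG; apply: clG; rewrite -zlift1U.
by move: eG => /= /(congr1 (addn^~ (M Z))); rewrite !subnK ?rank_zlift.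
Qed.

Lemma loopless_contract : flat M Z -> loopless contract.
Proof.
move=> flZ e; rewrite /indep eqn_leq mrank_card cards1 subn_gt0 /zlift imset_set1.
rewrite ltn_neqAle mrank_mono ?subsetUr // andbT.
by apply: contraNneq (valP e) => ZE; apply: (flatP _ _ flZ).
Qed.

Lemma pflats_contract G : Z != set0 ->
  G \in pflats contract = (zlift G \in pflats M) && (Z \proper zlift G).
Proof.
move=> Z0; rewrite !inE flat_contract properE sub_zlift /=.
have -> : (zlift G != set0).
  by apply: contra Z0 => /eqP G0; rewrite -subset0 -G0 sub_zlift.
have zl0 : zlift set0 = Z by rewrite /zlift imset0 set0U.
have -> : (G != set0) = ~~ (zlift G \subset Z).
  by rewrite -subset0 -zliftS zl0.
have -> : (zlift G == setT) = (G == setT).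
  have <- : zlift setT = setT; last by rewrite (inj_eq zlift_inj).
  apply/setP=> e; rewrite !inE orbC; have [//|eZ] := boolP (e \in Z).
  by apply/imsetP; exists (exist (fun e => e \notin Z) e eZ); rewrite ?inE.
by rewrite -!andbA; case: (flat M _) => //=; rewrite andbC.
Qed.

End Contraction.

Section QuotientRing.
Variables (R : comNzRingType) (G : R -> Prop).

Definition ideal_gen : {pred R} := fun f =>
  `[< exists2 s : seq (R * R), (forall c, c \in s -> G c.2) &
        f = \sum_(c <- s) c.1 * c.2 >].

Lemma ideal_genP f : reflect
  (exists2 s : seq (R * R), (forall c, c \in s -> G c.2) &
     f = \sum_(c <- s) c.1 * c.2) (f \in ideal_gen).
Proof. exact: asboolP. Qed.

Lemma ideal_genMl a f : f \in ideal_gen -> a * f \in ideal_gen.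
Proof.
move=> /ideal_genP[s sG ->]; apply/ideal_genP.
exists [seq (a * c.1, c.2) | c <- s]; first by move=> _ /mapP[c /sG ? ->].
by rewrite big_map mulr_sumr; apply: eq_bigr => c _; rewrite mulrA.
Qed.

Lemma mem_ideal_gen f : G f -> f \in ideal_gen.
Proof.
move=> Gf; apply/ideal_genP; exists [:: (1, f)]; last by rewrite big_seq1 mul1r.
by move=> c; rewrite inE => /eqP ->.
Qed.

Fact ideal_gen_zmod_closed : zmod_closed ideal_gen.
Proof.
split; first by apply/ideal_genP; exists [::]; rewrite ?big_nil.
move=> f g fI /(ideal_genMl (-1)); rewrite mulN1r.
case/ideal_genP: fI => [s sG ->] /ideal_genP[t tG ->]; apply/ideal_genP.
exists (s ++ t); last by rewrite big_cat.
by move=> c; rewrite mem_cat => /orP[/sG|/tG].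
Qed.

HB.instance Definition _ :=
  GRing.isZmodClosed.Build R ideal_gen ideal_gen_zmod_closed.

(* The library equips {quot I} with a multiplication only when I is proper;
   we want the quotient ring without that side condition. *)
Definition quotring : Type := {quot ideal_gen}.

HB.instance Definition _ := GRing.Zmodule.on quotring.

Definition qpi (f : R) : quotring := \pi_{quot ideal_gen} f.

Fact qpi_zmod_morphism : zmod_morphism qpi.
Proof. exact: pi_is_zmod_morphism. Qed.
HB.instance Definition _ :=
  GRing.isZmodMorphism.Build R quotring qpi qpi_zmod_morphism.

Lemma qpi_eq0 f : (qpi f == 0) = (f \in ideal_gen).
Proof. by rewrite -(raddf0 qpi) /qpi -idealrBE subr0. Qed.

Lemma qpi_eq f g : qpi f = qpi g <-> f - g \in ideal_gen.
Proof. by rewrite -qpi_eq0 raddfB subr_eq0; split=> /eqP. Qed.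

Lemma qpi_repr (a : quotring) : qpi (repr a) = a.
Proof. exact: reprK. Qed.

Definition qmul (a b : quotring) : quotring := qpi (repr a * repr b).

Lemma qpiM f g : qpi (f * g) = qmul (qpi f) (qpi g).
Proof.
have reprB h : h - repr (qpi h) \in ideal_gen by apply/qpi_eq; rewrite qpi_repr.
apply/qpi_eq; rewrite -[f * g](addrNK (f * repr (qpi g))) -addrA.
rewrite -mulrBr -mulrBl.
by apply: rpredD; last rewrite mulrC; apply: ideal_genMl.
Qed.

Fact qmulA : associative qmul.
Proof.
by move=> a b c; rewrite -[a]qpi_repr -[b]qpi_repr -[c]qpi_repr -!qpiM mulrA.
Qed.
Fact qmulC : commutative qmul.
Proof. by move=> a b; rewrite /qmul mulrC. Qed.
Fact qmul1 : left_id (qpi 1) qmul.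
Proof. by move=> a; rewrite -[a]qpi_repr -qpiM mul1r. Qed.
Fact qmulDl : left_distributive qmul +%R.
Proof.
move=> a b c; rewrite -[a]qpi_repr -[b]qpi_repr -[c]qpi_repr.
by rewrite -raddfD -!qpiM mulrDl raddfD.
Qed.

HB.instance Definition _ := GRing.Zmodule_isComPzRing.Build quotring
  qmulA qmulC qmul1 qmulDl.

Fact qpi_monoid_morphism : monoid_morphism qpi.
Proof. by split=> // f g; rewrite qpiM. Qed.
HB.instance Definition _ :=
  GRing.isMonoidMorphism.Build R quotring qpi qpi_monoid_morphism.

End QuotientRing.

Arguments qpi {R} G f.

(* A homomorphism that vanishes on the ideal factors through the quotient. *)
Section QuotientMap.
Variables (R R' : comNzRingType) (G : R -> Prop) (G' : R' -> Prop).

Definition qmap (f : R -> R') (a : quotring G) : quotring G' :=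
  qpi G' (f (repr a)).

Lemma qmapE (f : {additive R -> R'}) :
    (forall g, g \in ideal_gen G -> f g \in ideal_gen G') ->
  forall g, qmap f (qpi G g) = qpi G' (f g).
Proof.
move=> fI g; apply/qpi_eq; rewrite -raddfB; apply: fI; apply/qpi_eq.
by rewrite qpi_repr.
Qed.

Lemma rmorph_ideal (f : {rmorphism R -> R'}) (c : R') :
    (forall g, G g -> c * f g \in ideal_gen G') ->
  forall g, g \in ideal_gen G -> c * f g \in ideal_gen G'.
Proof.
move=> fG _ /ideal_genP[s sG ->]; rewrite rmorph_sum mulr_sumr big_seq.
by apply: rpred_sum => d /sG/fG dI; rewrite rmorphM mulrCA ideal_genMl.
Qed.

End QuotientMap.

Arguments qmap {R R' G G'} f a.

Definition pvar (V : finType) (v : V) : {mpoly int[#|V|]} := 'X_(enum_rank v).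

(* The ring homomorphism given by the substitution x_v := h v. *)
Definition psubst (V W : finType) (h : V -> {mpoly int[#|W|]})
  : {mpoly int[#|V|]} -> {mpoly int[#|W|]} :=
  mmap (@mpolyC #|W| int) (fun i => h (enum_val i)).

HB.instance Definition _ V W h := GRing.RMorphism.on (@psubst V W h).

Lemma psubst_pvar (V W : finType) (h : V -> {mpoly int[#|W|]}) v :
  psubst h (pvar v) = h v.
Proof. by rewrite /psubst /pvar mmapX mmap1U enum_rankK. Qed.

(* The degree is an integer, so that the pieces of negative degree are 0. *)
Definition homogz n (k : int) (f : {mpoly int[n]}) : bool :=
  all (fun m : 'X_{1..n} => (mdeg m)%:Z == k) (msupp f).

Lemma homogzP n k (f : {mpoly int[n]}) :
  homogz k f <-> (if k is Posz d then f \is d.-homog else f == 0).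
Proof.
case: k => d; first by rewrite dhomogE.
rewrite /homogz -msupp_eq0; split=> [|/eqP -> //].
by case: (msupp f) => [|m s].
Qed.

Lemma homogzB n k (f g : {mpoly int[n]}) :
  homogz k f -> homogz k g -> homogz k (f - g).
Proof.
move=> /homogzP fk /homogzP gk; apply/homogzP.
case: k fk gk => d fk gk; first by rewrite rpredB.
by rewrite (eqP fk) (eqP gk) subr0.
Qed.

Lemma homogzM n k l (f g : {mpoly int[n]}) :
  homogz k f -> homogz l g -> homogz (k + l) (f * g).
Proof.
move=> /homogzP fk /homogzP gl.
case: k l fk gl => k [] l fk gl;
  try by rewrite (eqP fk) mul0r /homogz msupp0.
- by apply/homogzP; rewrite -PoszD dhomogM.
- by rewrite (eqP gl) mulr0 /homogz msupp0.
Qed.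

Lemma homogz_psubst (V W : finType) (h : V -> {mpoly int[#|W|]}) k f :
  (forall v, h v \is 1.-homog) -> homogz k f -> homogz k (psubst h f).
Proof.
move=> h1 /homogzP fk; apply/homogzP.
case: k fk => d fk; last by rewrite (eqP fk) rmorph0.
rewrite /psubst /mmap big_seq; apply: rpred_sum => m mf.
rewrite mul_mpolyC; apply: rpredZ.
have {mf} <- : mdeg m = d by exact: dhomog_mf fk _ mf.
rewrite mdegE /mmap1; elim/big_ind2: _ => [|a p b r|i _].
- exact: dhomog1.
- exact: dhomogM.
- by have := dhomogMn (m i) (h1 (enum_val i)); rewrite mul1n.
Qed.

Section Graded.
Variables (n : nat) (G : {mpoly int[n]} -> Prop).

Definition grade (k : int) : {pred quotring G} := fun a =>
  `[< exists2 f, homogz k f & a = qpi G f >].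

Lemma gradeP k a :
  reflect (exists2 f, homogz k f & a = qpi G f) (a \in grade k).
Proof. exact: asboolP. Qed.

Fact grade_zmod_closed k : zmod_closed (grade k).
Proof.
split=> [|a b /gradeP[f fk ->] /gradeP[g gk ->]]; apply/gradeP.
  by exists 0; rewrite ?raddf0 // /homogz msupp0.
by exists (f - g); rewrite ?raddfB // homogzB.
Qed.
HB.instance Definition _ k :=
  GRing.isZmodClosed.Build (quotring G) (grade k) (grade_zmod_closed k).

(* The degree k part of the quotient ring, as an abelian group. *)
Record gpart (k : int) : Type :=
  GPart { gval : quotring G; gvalP : gval \in grade k }.

HB.instance Definition _ k := [isSub for @gval k].
HB.instance Definition _ k := [Choice of gpart k by <:].
HB.instance Definition _ k := [SubChoice_isSubZmodule of gpart k by <:].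

End Graded.

Arguments grade {n} G k.
Arguments gpart {n} G k.
Arguments gval {n G k} _.

Section DirectSum.
Variables (I : finType) (T : I -> zmodType).
Local Notation dsum := {dffun forall i : I, T i}.

Definition dsum0 : dsum := [ffun i => 0].
Definition dsumN (a : dsum) : dsum := [ffun i => - a i].
Definition dsumD (a b : dsum) : dsum := [ffun i => a i + b i].

Fact dsumA : associative dsumD.
Proof. by move=> a b c; apply/ffunP=> i; rewrite !ffunE addrA. Qed.
Fact dsumC : commutative dsumD.
Proof. by move=> a b; apply/ffunP=> i; rewrite !ffunE addrC. Qed.
Fact dsum0D : left_id dsum0 dsumD.
Proof. by move=> a; apply/ffunP=> i; rewrite !ffunE add0r. Qed.
Fact dsumND : left_inverse dsum0 dsumN dsumD.
Proof. by move=> a; apply/ffunP=> i; rewrite !ffunE addNr. Qed.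

HB.instance Definition _ := GRing.isZmodule.Build dsum
  dsumA dsumC dsum0D dsumND.

End DirectSum.

Section ChowFilter.
Variables (E : finType) (M : matroid E) (P : {set {set E}}).

Definition chow_var : finType := (E + {F : {set E} | F \in P})%type.
Definition chow_poly := {mpoly int[#|chow_var|]}.

Definition xelt (i : E) : chow_poly := pvar (inl i : chow_var).

(* The variable x_F when F is in P; only used for such F, and 0 otherwise. *)
Definition xset (F : {set E}) : chow_poly :=
  if insub F is Some F' then pvar (inr F' : chow_var) else 0.

Definition chow_lin (i : E) : chow_poly :=
  xelt i + \sum_(F in P | i \in F) xset F.

Inductive chow_rel : chow_poly -> Prop :=
| ChowIncomparable F1 F2 : F1 \in P -> F2 \in P ->
    ~~ (F1 \subset F2) -> ~~ (F2 \subset F1) ->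
    chow_rel (xset F1 * xset F2)
| ChowNotin i F : F \in P -> i \notin F -> chow_rel (xelt i * xset F)
| ChowIndep I : indep M I -> closure M I \in [set: E] |: P ->
    chow_rel (\prod_(i in I) xelt i)
| ChowLinear i j : i != j -> chow_rel (chow_lin i - chow_lin j).

Definition chow := quotring chow_rel.
Definition chow_gr (k : int) := gpart chow_rel k.

HB.instance Definition _ := GRing.ComPzRing.on chow.
HB.instance Definition _ k := GRing.Zmodule.on (chow_gr k).

Lemma xsetE (F : {F : {set E} | F \in P}) :
  xset (val F) = pvar (inr F : chow_var).
Proof. by rewrite /xset valK. Qed.

Lemma xelt_homog i : xelt i \is 1.-homog.
Proof. by rewrite dhomogX /= mdeg1. Qed.

Lemma xset_homog F : xset F \is 1.-homog.
Proof. by rewrite /xset; case: insub => [G|]; rewrite ?rpred0 // dhomogX /= mdeg1. Qed.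

End ChowFilter.

Arguments xelt {E} P i.
Arguments xset {E} P F.
Arguments chow_lin {E} P i.
Arguments chow_rel {E} M P _.

Section ChowFlats.
Variables (E : finType) (N : matroid E).

Definition fchow_var : finType := {F : {set E} | F \in pflats N}.
Definition fchow_poly := {mpoly int[#|fchow_var|]}.

(* As for xset: 0 outside the nonempty proper flats. *)
Definition fxset (F : {set E}) : fchow_poly :=
  if insub F is Some F' then pvar (F' : fchow_var) else 0.

Definition fchow_lin (i : E) : fchow_poly :=
  \sum_(F in pflats N | i \in F) fxset F.

Inductive fchow_rel : fchow_poly -> Prop :=
| FChowIncomparable F1 F2 : F1 \in pflats N -> F2 \in pflats N ->
    ~~ (F1 \subset F2) -> ~~ (F2 \subset F1) ->
    fchow_rel (fxset F1 * fxset F2)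
| FChowLinear i j : i != j -> fchow_rel (fchow_lin i - fchow_lin j).

Definition fchow := quotring fchow_rel.
Definition fchow_gr (k : int) := gpart fchow_rel k.

HB.instance Definition _ := GRing.ComPzRing.on fchow.
HB.instance Definition _ k := GRing.Zmodule.on (fchow_gr k).

Lemma fxsetE (F : fchow_var) : fxset (val F) = pvar F.
Proof. by rewrite /fxset valK. Qed.

End ChowFlats.

Arguments fchow_rel {E} N _.

Definition max_outside E (M : matroid E) (P : {set {set E}}) (Z : {set E}) :=
  maxset (fun F => F \in pflats M :\: P) Z.

Section Flip.
Variables (E : finType) (M : matroid E) (P : {set {set E}}) (Z : {set E}).
Local Notation "P+" := (Z |: P).
Local Notation N := (contract M Z).

Definition Phi_var (v : chow_var P) : chow_poly P+ :=
  match v with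
  | inl i => if i \in Z then xelt P+ i + xset P+ Z else xelt P+ i
  | inr F => xset P+ (val F)
  end.

Definition Phi_poly : chow_poly P -> chow_poly P+ := psubst Phi_var.
HB.instance Definition _ := GRing.RMorphism.on Phi_poly.

(* Psi multiplies by x_Z ^ p after x_G := x_(zlift G); on the monomial of a
   chain this is its defining formula, see Psi_monomial. *)
Definition Psi_var (G : fchow_var N) : chow_poly P+ := xset P+ (zlift (val G)).

Definition Psi_poly (p : nat) (f : fchow_poly N) : chow_poly P+ :=
  xset P+ Z ^+ p * psubst Psi_var f.

Fact Psi_poly_zmod_morphism p : zmod_morphism (Psi_poly p).
Proof. by move=> f g; rewrite /Psi_poly raddfB mulrBr. Qed.
HB.instance Definition _ p :=
  GRing.isZmodMorphism.Build _ _ (Psi_poly p) (Psi_poly_zmod_morphism p).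

Hypotheses (hP : order_filter M P) (hZ : max_outside M P Z).

Let pfZ : Z \in pflats M.
Proof. by have := maxsetp hZ; rewrite inE => /andP[]. Qed.

Let ZnP : Z \notin P.
Proof. by have := maxsetp hZ; rewrite inE => /andP[]. Qed.

Let flZ : flat M Z. Proof. by move: pfZ; rewrite inE => /and3P[]. Qed.
Let ZN0 : Z != set0. Proof. by move: pfZ; rewrite inE => /and3P[]. Qed.
Let ZNT : Z != setT. Proof. by move: pfZ; rewrite inE => /and3P[]. Qed.

Let ZP : Z \in P+. Proof. exact: setU11. Qed.
Let PP F : F \in P -> F \in P+. Proof. exact: setU1r. Qed.

Let subZ F : F \in P -> ~~ (F \subset Z).
Proof. by move=> FP; apply: contra ZnP => /(hP.2 _ _ FP pfZ). Qed.

Let supZ F : F \in pflats M -> Z \proper F -> F \in P.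
Proof.
move=> Ff ZF; apply: contraTT ZF => FnP; rewrite properE.
have [ZF|//] := boolP (Z \subset F).
by rewrite (maxsetsup hZ _ ZF) ?subxx // inE FnP.
Qed.

Lemma Phi_xelt i : Phi_poly (xelt P i)
  = if i \in Z then xelt P+ i + xset P+ Z else xelt P+ i.
Proof. by rewrite /Phi_poly psubst_pvar. Qed.

Lemma Phi_xset F : F \in P -> Phi_poly (xset P F) = xset P+ F.
Proof.
move=> FP; rewrite -[F]/(val (exist (fun F => F \in P) F FP)) xsetE.
by rewrite /Phi_poly psubst_pvar.
Qed.

Lemma Phi_lin i : Phi_poly (chow_lin P i) = chow_lin P+ i.
Proof.
rewrite raddfD raddf_sum /= Phi_xelt /chow_lin.
rewrite [in RHS]big_mkcondr big_setU1 //= -big_mkcondr addrA; congr (_ + _).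
  by case: ifP; rewrite ?addr0.
by apply: eq_bigr => F /andP[FP _]; rewrite Phi_xset.
Qed.

(* x_j x_Z = 0 for j outside Z, so the terms with x_Z drop out. *)
Lemma Phi_prod (s : seq E) j : j \notin Z ->
  qpi (chow_rel M P+) (xelt P+ j * \prod_(i <- s) Phi_poly (xelt P i))
  = qpi (chow_rel M P+) (xelt P+ j * \prod_(i <- s) xelt P+ i).
Proof.
move=> jZ; elim: s => [|i s IH]; first by rewrite !big_nil.
rewrite !big_cons !(mulrCA (xelt P+ j)).
rewrite rmorphM /= IH -rmorphM Phi_xelt; case: ifP => // _.
rewrite mulrDl raddfD /= [X in _ + X](_ : _ = 0) ?addr0 //.
apply/eqP; rewrite qpi_eq0 mulrA mulrC ideal_genMl // mulrC.
exact/mem_ideal_gen/ChowNotin.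
Qed.

Lemma Phi_ideal f :
  f \in ideal_gen (chow_rel M P) -> Phi_poly f \in ideal_gen (chow_rel M P+).
Proof.
move=> fI; rewrite -[Phi_poly f]mul1r.
apply: rmorph_ideal fI => {}f; rewrite mul1r; case=> [F1 F2 F1P F2P F12 F21|i F FP iF|I indI clI|i j ij].
- rewrite rmorphM /= !Phi_xset //; apply/mem_ideal_gen.
  by apply: ChowIncomparable; rewrite ?PP.
- rewrite rmorphM /= Phi_xset // Phi_xelt; case: ifP => iZ.
    rewrite mulrDl rpredD //; apply/mem_ideal_gen.
      by apply: ChowNotin; rewrite ?PP.
    apply: ChowIncomparable; rewrite ?subZ //; first exact: PP.
    by apply: contra iF => /subsetP; apply.
  by apply/mem_ideal_gen/ChowNotin; rewrite ?PP.
- have /subsetPn[j jI jZ] : ~~ (I \subset Z).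
    apply/negP => /(closure_mono M); rewrite (eqP flZ) => clZ.
    case/setU1P: clI clZ => [->|clP]; first by rewrite subTset (negbTE ZNT).
    by rewrite (negbTE (subZ clP)).
  rewrite rmorph_prod (bigD1 j) //= Phi_xelt (negbTE jZ) -big_filter.
  rewrite -qpi_eq0 Phi_prod // big_filter -bigD1 // qpi_eq0.
  apply/mem_ideal_gen/ChowIndep => //.
  by case/setU1P: clI => [->|/PP clP]; rewrite in_setU1 ?eqxx ?clP ?orbT.
- by rewrite raddfB /= !Phi_lin; apply/mem_ideal_gen/ChowLinear.
Qed.

Lemma zlift_in_P G : G \in pflats N -> zlift G \in P.
Proof. by rewrite pflats_contract // => /andP[/supZ]. Qed.

Lemma Psi_fxset G : G \in pflats N ->
  psubst Psi_var (fxset N G) = xset P+ (zlift G).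
Proof.
move=> Gf; rewrite -[G]/(val (exist (fun F => F \in pflats N) G Gf)) fxsetE.
by rewrite psubst_pvar.
Qed.

Lemma Psi_lin (i : {e : E | e \notin Z}) :
  qpi (chow_rel M P+) (xset P+ Z * psubst Psi_var (fchow_lin N i))
  = qpi (chow_rel M P+) (xset P+ Z * chow_lin P+ (val i)).
Proof.
rewrite /chow_lin mulrDr raddfD [X in X + _](_ : _ = 0); last first.
  apply/eqP; rewrite qpi_eq0 mulrC; apply/mem_ideal_gen/ChowNotin => //.
  exact: (valP i).
rewrite add0r [in RHS](bigID (fun F : {set E} => Z \subset F)) /= mulrDr raddfD /=.
rewrite [X in _ + X](_ : _ = 0) ?addr0; last first.
  apply/eqP; rewrite qpi_eq0 mulr_sumr rpred_sum // => F /andP[/andP[FP iF] ZF].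
  apply/mem_ideal_gen/ChowIncomparable => //.
  by apply: contra (valP i) => /subsetP; apply.
congr (qpi _ (_ * _)); rewrite raddf_sum /=.
rewrite (reindex_onto (@zlift E Z) (fun F => val @^-1: F)) /=; last first.
  move=> F /andP[_ /subsetP ZF]; apply/setP=> e; rewrite inE.
  have [eZ|eZ] := boolP (e \in Z); first by rewrite orbT ZF.
  rewrite orbF; apply/imsetP/idP=> [[d]|eF]; first by rewrite inE => dF ->.
  by exists (exist (fun e => e \notin Z) e eZ); rewrite ?inE.
apply: congr_big => // [G|G /andP[Gf _]]; last exact: Psi_fxset.
rewrite zlift_mem sub_zlift !andbT.
have -> : val @^-1: zlift G == G.
  by apply/eqP/setP=> e; rewrite inE zlift_mem.
rewrite andbT; have [iG|] := boolP (i \in G); rewrite ?andbF // !andbT.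
apply/idP/idP=> [/zlift_in_P/PP //|/setU1P[GZ|GP]].
  by move: iG; rewrite -zlift_mem GZ (negbTE (valP i)).
rewrite pflats_contract // (subsetP hP.1) // properE sub_zlift.
by apply/subsetPn; exists (val i); rewrite ?zlift_mem // (valP i).
Qed.

Lemma Psi_ideal p f : (0 < p)%N ->
  f \in ideal_gen (fchow_rel N) -> Psi_poly p f \in ideal_gen (chow_rel M P+).
Proof.
move=> p0 fI; apply: rmorph_ideal fI => {}f.
rewrite -(prednK p0) exprSr -mulrA => relf; apply: ideal_genMl.
case: relf => [F1 F2 F1f F2f F12 F21|i j ij].
  rewrite rmorphM /= !Psi_fxset //; apply/ideal_genMl/mem_ideal_gen.
  by apply: ChowIncomparable; rewrite ?PP ?zlift_in_P ?zliftS.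
rewrite raddfB mulrBr -qpi_eq0 raddfB /= !Psi_lin -raddfB -mulrBr qpi_eq0.
apply/ideal_genMl/mem_ideal_gen/ChowLinear.
by rewrite (inj_eq val_inj).
Qed.


Lemma Phi_var_homog v : Phi_var v \is 1.-homog.
Proof.
case: v => [i|F] /=; last exact: xset_homog.
case: ifP => _; last exact: xelt_homog.
by apply: rpredD; [exact: xelt_homog | exact: xset_homog].
Qed.

Lemma Phi_poly_homog k f : homogz k f -> homogz k (Phi_poly f).
Proof. exact/homogz_psubst/Phi_var_homog. Qed.

Lemma Psi_poly_homog p k f :
  homogz (k - p%:Z) f -> homogz k (Psi_poly p f).
Proof.
move=> fk; rewrite -[k](subrK p%:Z) addrC; apply: homogzM.
  apply/homogzP; have := dhomogMn p (xset_homog P+ Z).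
  by rewrite mul1n.
by apply: homogz_psubst fk => v; apply: xset_homog.
Qed.

End Flip.

Section FlipMaps.
Variables (E : finType) (M : matroid E) (P : {set {set E}}) (Z : {set E}).
Hypotheses (hP : order_filter M P) (hZ : max_outside M P Z).
Local Notation "P+" := (Z |: P).
Local Notation N := (contract M Z).

(* qmap is a homomorphism only because Phi_poly maps the ideal into the ideal,
   which needs the two hypotheses; they are arguments so that the morphism
   instances below can be inferred. *)
Definition Phi (_ : order_filter M P) (_ : max_outside M P Z) :
  chow M P -> chow M P+ := qmap (@Phi_poly E P Z).

Definition Psi (p : nat) (_ : order_filter M P) (_ : max_outside M P Z)
  (_ : (0 < p)%N) : fchow N -> chow M P+ := qmap (@Psi_poly E M P Z p).

Lemma PhiE f :
  Phi hP hZ (qpi (chow_rel M P) f) = qpi (chow_rel M P+) (Phi_poly Z f).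
Proof. exact/qmapE/Phi_ideal. Qed.

Lemma PsiE p (p0 : (0 < p)%N) f :
  Psi hP hZ p0 (qpi (fchow_rel N) f) = qpi (chow_rel M P+) (Psi_poly P p f).
Proof. by apply/qmapE=> g; apply: Psi_ideal. Qed.

Fact Phi_zmod_morphism : zmod_morphism (Phi hP hZ).
Proof.
by move=> a b; rewrite -[a]qpi_repr -[b]qpi_repr -raddfB !PhiE !raddfB.
Qed.
HB.instance Definition _ :=
  GRing.isZmodMorphism.Build _ _ (Phi hP hZ) Phi_zmod_morphism.

Fact Phi_monoid_morphism : monoid_morphism (Phi hP hZ).
Proof.
split=> [|a b]; first by rewrite -(rmorph1 (qpi _)) PhiE !rmorph1.
by rewrite -[a]qpi_repr -[b]qpi_repr -rmorphM !PhiE !rmorphM.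
Qed.
HB.instance Definition _ :=
  GRing.isMonoidMorphism.Build _ _ (Phi hP hZ) Phi_monoid_morphism.

Fact Psi_zmod_morphism p (p0 : (0 < p)%N) : zmod_morphism (Psi hP hZ p0).
Proof.
by move=> a b; rewrite -[a]qpi_repr -[b]qpi_repr -raddfB !PsiE !raddfB.
Qed.
HB.instance Definition _ p p0 :=
  GRing.isZmodMorphism.Build _ _ (@Psi p hP hZ p0) (@Psi_zmod_morphism p p0).

Lemma Phi_gen_elt i : Phi hP hZ (qpi _ (xelt P i))
  = qpi _ (if i \in Z then xelt P+ i + xset P+ Z else xelt P+ i).
Proof. by rewrite PhiE Phi_xelt. Qed.

Lemma Phi_gen_set F : F \in P ->
  Phi hP hZ (qpi _ (xset P F)) = qpi _ (xset P+ F).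
Proof. by move=> FP; rewrite PhiE Phi_xset. Qed.

Lemma Psi_monomial p (p0 : (0 < p)%N) (s : seq {set {e : E | e \notin Z}}) :
    {subset s <= pflats N} ->
  Psi hP hZ p0 (qpi _ (\prod_(G <- s) fxset N G))
  = qpi _ (xset P+ Z ^+ p * \prod_(G <- s) xset P+ (zlift G)).
Proof.
move=> sN; rewrite PsiE /Psi_poly rmorph_prod; congr (qpi _ (_ * _)).
by apply: eq_big_seq => G /sN Gf; rewrite /= Psi_fxset.
Qed.

Lemma Phi_grade k a :
  a \in grade (chow_rel M P) k -> Phi hP hZ a \in grade (chow_rel M P+) k.
Proof.
case/gradeP=> f fk ->; apply/gradeP; exists (Phi_poly Z f); last exact: PhiE.
exact: Phi_poly_homog.
Qed.

Lemma Psi_grade p (p0 : (0 < p)%N) k a :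
  a \in grade (fchow_rel N) (k - p%:Z) ->
  Psi hP hZ p0 a \in grade (chow_rel M P+) k.
Proof.
case/gradeP=> f fk ->; apply/gradeP; exists (Psi_poly P p f); last exact: PsiE.
exact: Psi_poly_homog.
Qed.

End FlipMaps.

Section FlipSum.
Variables (E : finType) (M : matroid E) (P : {set {set E}}) (Z : {set E}).
Variables (hP : order_filter M P) (hZ : max_outside M P Z) (q : nat).
Local Notation "P+" := (Z |: P).
Local Notation N := (contract M Z).

Definition Phi_gr (a : chow_gr M P q%:Z) : chow_gr M P+ q%:Z :=
  GPart (Phi_grade hP hZ (gvalP a)).

Definition Psi_gr p (p0 : (0 < p)%N) (b : fchow_gr N (q%:Z - p%:Z)) :
  chow_gr M P+ q%:Z := GPart (Psi_grade hP hZ p0 (gvalP b)).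

(* The index i stands for the exponent p = i + 1 between 1 and rk Z - 1. *)
Definition flip_source : zmodType :=
  (chow_gr M P q%:Z *
   {dffun forall i : 'I_(M Z).-1, fchow_gr N (q%:Z - i.+1%:Z)})%type.

Definition flip_map (a : flip_source) : chow_gr M P+ q%:Z :=
  Phi_gr a.1 + \sum_(i < (M Z).-1) Psi_gr (ltn0Sn i) (a.2 i).

Fact Phi_gr_zmod_morphism : zmod_morphism Phi_gr.
Proof. by move=> a b; apply/val_inj; rewrite /= !raddfB. Qed.
HB.instance Definition _ :=
  GRing.isZmodMorphism.Build _ _ Phi_gr Phi_gr_zmod_morphism.

Fact Psi_gr_zmod_morphism p (p0 : (0 < p)%N) : zmod_morphism (Psi_gr p0).
Proof. by move=> a b; apply/val_inj; rewrite /= !raddfB. Qed.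
HB.instance Definition _ p p0 :=
  GRing.isZmodMorphism.Build _ _ (@Psi_gr p p0) (@Psi_gr_zmod_morphism p p0).

Fact flip_map_zmod_morphism : zmod_morphism flip_map.
Proof.
move=> a b; rewrite /flip_map raddfB opprD addrACA; congr (_ + _).
rewrite -sumrB; apply: eq_bigr => i _; rewrite -raddfB; congr (Psi_gr _ _).
by rewrite /= !ffunE.
Qed.
HB.instance Definition _ :=
  GRing.isZmodMorphism.Build flip_source _ flip_map flip_map_zmod_morphism.

End FlipSum.

Arguments flip_map {E M P Z} hP hZ q a.

(* Main.v *)
(*
  [A(M, P+)] is related to [A(M, P)] as the Chow ring of a blow-up along a
  smooth centre with Chow ring [C := A(M_Z)] (Keel). There is a surjective
  restriction [A(M, P) -> C]: it keeps the [x_F] with [Z] in [F], kills the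
  other [x_F] and the [x_i] with [i] outside [Z], and sends all the [x_i] with
  [i] in [Z] to one class [alpha]. In [A(M, P)], multiplication by
  [x_I = \prod_(i in I) x_i], for a basis [I] of [Z], factors through the
  restriction, and so does multiplication by [T = x_Z] in [A(M, P+)].

  Let [d = rk Z].  Injectivity: sending [x_F] to [(x_F, x_F)], [x_Z] to [(0, X)],
  and [x_i] to [(x_i, alpha - X)] or [(x_i, 0)] maps [A(M, P+)] to the quotient
  of the fibre product of [A(M, P)] and [C[X]] over [C] by the pairs
  [(x_I f(0), f (alpha - X)^d)]. An element of the source of the flip map has
  an image of degree less than [d] in [X], and [(alpha - X)^d] is monic up to
  sign, so that this image is such a pair only for [f = 0].
  Surjectivity: the image of the flip map is stable under multiplication by
  the generators, because [\prod_(i in I) (x_i - T) = 0] turns [T ^ d] into a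
  combination of lower powers of [T].
*)
Require Import Defs.
From HB Require Import structures.
From mathcomp Require Import all_boot all_order all_algebra.
From mathcomp Require Import boolp mpoly.

Set Implicit Arguments.
Unset Strict Implicit.
Unset Printing Implicit Defensive.

(* [closure] is also a notion of [fingraph]. *)
Import GRing.Theory Defs.
Local Open Scope ring_scope.

(** * Bases of a flat *)

Section MatroidTheory.
Variables (E : finType) (M : matroid E).
Implicit Types (A B F I J : {set E}).

(** A maximal set of rank [M A] between [A] and its closure absorbs each [e] of the closure, by
    submodularity. *)
Lemma rank_closure A : M (closure M A) = M A.
Proof.
pose p B := [&& A \subset B, B \subset closure M A & M B == M A].
have [B /maxsetP[/and3P[AB BcA /eqP MB] maxB]] : {B | maxset p B}.
  by case: (@maxset_exists _ p A) => [|B ? _];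
    [rewrite /p subxx sub_closure eqxx | exists B].
suff -> : closure M A = B by [].
apply/eqP; rewrite eqEsubset BcA andbT; apply/subsetP => e eA.
rewrite -(maxB (e |: B)) ?setU11 ?subsetUr //.
apply/and3P; split; first exact: subset_trans AB (subsetUr _ _).
  by rewrite subUset sub1set eA.
move: (eA); rewrite inE => /eqP Me; rewrite -MB eqn_leq.
rewrite [X in _ && X]mrank_mono ?subsetUr // andbT.
have := mrank_submod M (e |: A) B; rewrite -setUA (setUidPr AB) Me => le1.
rewrite -(leq_add2r (M A)) [leqRHS]addnC; apply: leq_trans le1.
by rewrite leq_add2l mrank_mono // subsetI subsetUr.
Qed.


Lemma flat_closure A : flat M (closure M A).
Proof.
apply/flatP => e; rewrite rank_closure inE => Me.
rewrite eqn_leq [X in _ && X]mrank_mono ?subsetUr // andbT -[leqRHS]Me.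
by rewrite mrank_mono // setUS // sub_closure.
Qed.

Definition mbasis F I : bool := [&& I \subset F, indep M I & M I == M F].

Lemma basis_card F I : mbasis F I -> #|I| = M F.
Proof. by case/and3P => _ /eqP <- /eqP. Qed.

Lemma basis_exists F : exists I, mbasis F I.
Proof.
pose p B := (B \subset F) && indep M B.
have [|I /maxsetP[/andP[IF indI] maxI] _] := @maxset_exists _ p set0.
  by rewrite /p sub0set /indep eqn_leq mrank_card cards0.
exists I; apply/and3P; split => //.
have FI : F \subset closure M I.
  apply/subsetP => e eF; have [eI|eI] := boolP (e \in I).
    exact: (subsetP (sub_closure M I)).
  rewrite inE; apply: contraNT eI => neq.
  rewrite -(maxI (e |: I)) ?setU11 ?subsetUr // /p subUset sub1set eF IF /=.
  rewrite /indep eqn_leq mrank_card /= cardsU1.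
  apply: leq_trans (leq_add (leq_b1 _) (leqnn _)) _; rewrite add1n.
  by rewrite -(eqP indI) ltn_neqAle eq_sym neq mrank_mono ?subsetUr.
by rewrite eqn_leq mrank_mono //= -[leqRHS]rank_closure mrank_mono.
Qed.

Lemma closure_basis F I : flat M F -> mbasis F I -> closure M I = F.
Proof.
move=> flF /and3P[IF _ /eqP MI]; apply/eqP; rewrite eqEsubset.
rewrite -{1}(eqP flF) closure_mono //=; apply/subsetP => e eF; rewrite inE.
rewrite eqn_leq [X in _ && X]mrank_mono ?subsetUr // andbT MI mrank_mono //.
by rewrite subUset sub1set eF.
Qed.

Lemma basis_closure F I : indep M I -> closure M I = F -> mbasis F I.
Proof.
by move=> indI <-; rewrite /mbasis sub_closure indI rank_closure eqxx.
Qed.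

Lemma indepU1 I e : indep M I -> e \notin closure M I -> indep M (e |: I).
Proof.
move=> indI; rewrite inE /indep => neq; rewrite eqn_leq mrank_card /= cardsU1.
apply: leq_trans (leq_add (leq_b1 _) (leqnn _)) _; rewrite add1n.
by rewrite -(eqP indI) ltn_neqAle eq_sym neq mrank_mono ?subsetUr.
Qed.

Lemma indepS I J : J \subset I -> indep M I -> indep M J.
Proof.
move=> JI /eqP indI; rewrite /indep eqn_leq mrank_card /=.
have := setID I J; rewrite (setIidPr JI) => IE.
have := mrank_setU M J (I :\: J); rewrite IE indI -(cardsID J I) (setIidPr JI) => le1.
rewrite -(leq_add2r #|I :\: J|); apply: leq_trans le1 _.
by rewrite leq_add2l mrank_card.
Qed.

(** The rank of [I :\ i] is too small for its closure to contain [J]; an element of [J] outside that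
    closure restores the rank. *)
Lemma basis_exchange F I J i : mbasis F I -> mbasis F J -> i \in I :\: J ->
  exists2 j, j \in J :\: I & mbasis F (j |: (I :\ i)).
Proof.
move=> bI bJ; rewrite inE => /andP[iJ iI].
have/and3P[IF indI /eqP MI] := bI; have/and3P[JF indJ /eqP MJ] := bJ.
have indIi : indep M (I :\ i) by apply: indepS indI; apply: subsetDl.
have MIi : (M (I :\ i) < M F)%N.
  by rewrite (eqP indIi) -(basis_card bI) (cardsD1 i I) iI.
have /subsetPn[j jJ jI] : ~~ (J \subset closure M (I :\ i)).
  apply: contraL MIi => /(mrank_mono M).
  by rewrite rank_closure -leqNgt MJ.
have ji : j != i by apply: contraNneq iJ => <-.
have jIi : j \notin I :\ i by apply: contra jI; apply: (subsetP (sub_closure _ _)).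
exists j; first by move: jIi; rewrite !inE jJ ji /= => ->.
have indj := indepU1 indIi jI.
apply/and3P; split => //.
  by rewrite subUset sub1set (subsetP JF) //= (subset_trans _ IF) // subsetDl.
by rewrite (eqP indj) cardsU1 jIi -(basis_card bI) (cardsD1 i I) iI.
Qed.

End MatroidTheory.

(** * Restriction to the contraction *)

Section Evaluation.
Variables (V : finType).

(** Agreement after multiplication by [t] passes to sums and products. The factor [t] serves
    [supported_restr]. *)
Lemma mul_rmorph_eq (R : comPzRingType) (t : R)
    (g h : {rmorphism {mpoly int[#|V|]} -> R}) :
    (forall v : V, t * g (pvar v) = t * h (pvar v)) ->
  forall f, t * g f = t * h f.
Proof.
move=> gh f.
have mulK a b : t * g a = t * h a -> t * g b = t * h b -> t * g (a * b) = t * h (a * b).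
  by move=> ga gb; rewrite !rmorphM mulrA ga mulrAC gb mulrAC mulrA.
elim/mpolyind: f => [|c m f _ _ IH]; first by rewrite !rmorph0.
rewrite !rmorphD !mulrDr IH -mul_mpolyC -[c]intz rmorph_int.
congr (_ + _); apply: (mulK); first by rewrite !rmorph_int.
rewrite mpolyXE_id; elim/big_rec: _ => [|i a _ IHa]; first by rewrite !rmorph1.
apply: (mulK) => //; elim: (m i) => [|k IHk]; first by rewrite expr0 !rmorph1.
by rewrite exprS; apply: (mulK) => //; have := gh (enum_val i); rewrite /pvar enum_valK.
Qed.

Lemma rmorph_eq (R : comPzRingType) (g h : {rmorphism {mpoly int[#|V|]} -> R}) :
  (forall v : V, g (pvar v) = h (pvar v)) -> g =1 h.
Proof.
by move=> gh f; rewrite -[LHS]mul1r -[RHS]mul1r; apply: mul_rmorph_eq => v; rewrite gh.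
Qed.

Variables (S : comNzRingType) (h : V -> S).

Definition peval : {mpoly int[#|V|]} -> S :=
  mmap (intmul 1) (fun i => h (enum_val i)).

HB.instance Definition _ := GRing.RMorphism.on peval.

Lemma peval_pvar v : peval (pvar v) = h v.
Proof. by rewrite /peval /pvar mmapX mmap1U enum_rankK. Qed.

End Evaluation.

Section Quotient.
Variables (R : comNzRingType) (G : R -> Prop).

Lemma qpi_rel f : G f -> qpi G f = 0.
Proof. by move=> Gf; apply/eqP; rewrite qpi_eq0 mem_ideal_gen. Qed.

Lemma rmorph_ideal0 (R' : comPzRingType) (t : R') (g : {rmorphism R -> R'}) :
  (forall f, G f -> t * g f = 0) -> forall f, f \in ideal_gen G -> t * g f = 0.
Proof.
move=> G0 _ /ideal_genP[s sG ->]; rewrite rmorph_sum mulr_sumr big_seq.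
by apply: big1 => c /sG/G0 tc; rewrite rmorphM mulrCA tc mulr0.
Qed.

End Quotient.

(** * The map from [A(M, P)] to [A(M_Z)] and its lift *)

Section Restriction.
Variables (E : finType) (M : matroid E) (P : {set {set E}}) (Z : {set E}).
Hypotheses (hP : order_filter M P) (hZ : max_outside M P Z).
Local Notation EZ := {e : E | e \notin Z}.
Local Notation N := (contract M Z).
Variable (j0 : EZ).

Lemma Z_pflat : Z \in pflats M.
Proof. by have := maxsetp hZ; rewrite inE => /andP[]. Qed.

Lemma Z_notin : Z \notin P.
Proof. by have := maxsetp hZ; rewrite inE => /andP[]. Qed.

Lemma Z_flat : flat M Z. Proof. by have := Z_pflat; rewrite inE => /and3P[]. Qed.

Lemma Z_neq0 : Z != set0. Proof. by have := Z_pflat; rewrite inE => /and3P[]. Qed.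

Lemma Z_neqT : Z != setT. Proof. by have := Z_pflat; rewrite inE => /and3P[]. Qed.

Lemma in_P_above (F : {set E}) : F \in pflats M -> Z \proper F -> F \in P.
Proof.
move=> Ff ZF; apply: contraTT ZF => FnP; rewrite properE.
have [ZF|//] := boolP (Z \subset F).
by rewrite (maxsetsup hZ _ ZF) ?subxx // inE FnP.
Qed.

Lemma P_flat (F : {set E}) : F \in P -> flat M F.
Proof. by move/(subsetP hP.1); rewrite inE => /and3P[]. Qed.

Lemma P_not_sub (F : {set E}) : F \in P -> ~~ (F \subset Z).
Proof. by move=> FP; apply: contra Z_notin; apply: (hP.2 _ _ FP Z_pflat). Qed.

(** Neither [E] nor a member of [P] lies in [Z]. Hence each product relation of [A(M, P)] has a
    factor [x_j] that the restriction kills. *)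
Lemma spanning_meets (I : {set E}) : closure M I \in setT |: P ->
  exists2 j, j \in I & j \notin Z.
Proof.
move=> clI; apply/subsetPn/negP => /(closure_mono M); rewrite (eqP Z_flat) => clZ.
case/setU1P: clI clZ => [->|clP]; first by rewrite subTset (negbTE Z_neqT).
by rewrite (negbTE (P_not_sub clP)).
Qed.

Lemma closureU1_in (I : {set E}) j : j \notin Z -> Z \subset closure M I ->
  closure M (j |: I) \in setT |: P.
Proof.
move=> jZ ZI; rewrite in_setU1; case: eqP => //= /eqP nT.
have Zcl : Z \subset closure M (j |: I).
  by apply: subset_trans ZI _; apply: closure_mono; apply: subsetUr.
have jcl : j \in closure M (j |: I) by rewrite (subsetP (sub_closure _ _)) ?setU11.
apply: in_P_above.
  by rewrite inE flat_closure nT andbT; apply/set0Pn; exists j.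
by rewrite properE Zcl; apply/subsetPn; exists j.
Qed.

Lemma preim_zlift (G : {set EZ}) : val @^-1: zlift G = G.
Proof. by apply/setP=> e; rewrite inE zlift_mem. Qed.

Lemma zlift_preim (F : {set E}) : Z \subset F -> zlift (val @^-1: F : {set EZ}) = F.
Proof.
move=> /subsetP ZF; apply/setP=> e; rewrite inE.
have [eZ|eZ] := boolP (e \in Z); first by rewrite orbT ZF.
rewrite orbF; apply/imsetP/idP=> [[d]|eF]; first by rewrite inE => dF ->.
by exists (exist (fun e => e \notin Z) e eZ); rewrite ?inE.
Qed.

Lemma mem_P_above (F : {set E}) : Z \subset F ->
  (F \in P) = ((val @^-1: F : {set EZ}) \in pflats N).
Proof.
move=> ZF; rewrite pflats_contract ?Z_neq0 // zlift_preim //.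
apply/idP/andP => [FP|[Ff]]; last exact: in_P_above.
by rewrite (subsetP hP.1) // properE ZF P_not_sub.
Qed.

Lemma zlift_P (G : {set EZ}) : (zlift G \in P) = (G \in pflats N).
Proof. by rewrite mem_P_above ?sub_zlift // preim_zlift. Qed.

Lemma sum_above (V : zmodType) (Q : pred {set E}) (g : {set E} -> V) :
  \sum_(F in P | (Z \subset F) && Q F) g F
  = \sum_(G in pflats N | Q (zlift G)) g (zlift G).
Proof.
rewrite (reindex_onto (@zlift E Z) (fun F => val @^-1: F)) /=.
  by apply: eq_bigl => G; rewrite sub_zlift zlift_P preim_zlift eqxx andbT.
by move=> F /and3P[_ ZF _]; apply: zlift_preim.
Qed.

(* The multiples of [x_Z] see [x_i], for [i] in [Z], as this class: it is the
   linear form of [j0] with the part that is the same for all elements of [Z]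
   removed. *)
Definition normal_class : fchow_poly N :=
  fchow_lin N j0 - \sum_(G in pflats N) fxset N G.

Definition restr_var (v : chow_var P) : fchow_poly N :=
  match v with
  | inl i => if i \in Z then normal_class else 0
  | inr F => if Z \subset val F then fxset N (val @^-1: val F) else 0
  end.

Definition restr_poly : chow_poly P -> fchow_poly N := psubst restr_var.
HB.instance Definition _ := GRing.RMorphism.on restr_poly.

(** A section of the restriction on the variables. It respects the linear relations after
    multiplication by a suitable [t], see [supported_ideal]. *)
Definition lift_var (G : fchow_var N) : chow_poly P := xset P (zlift (val G)).

Definition lift_poly : fchow_poly N -> chow_poly P := psubst lift_var.
HB.instance Definition _ := GRing.RMorphism.on lift_poly.

Lemma restr_xelt i : restr_poly (xelt P i) = if i \in Z then normal_class else 0.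
Proof. by rewrite /restr_poly psubst_pvar. Qed.

Lemma restr_xset (F : {set E}) : F \in P -> restr_poly (xset P F)
  = if Z \subset F then fxset N (val @^-1: F) else 0.
Proof.
move=> FP; rewrite -[F in LHS]/(val (exist (fun F => F \in P) F FP)) xsetE.
by rewrite /restr_poly psubst_pvar.
Qed.

Lemma lift_fxset G : G \in pflats N -> lift_poly (fxset N G) = xset P (zlift G).
Proof.
move=> Gf; rewrite -[G in LHS]/(val (exist (fun F => F \in pflats N) G Gf)) fxsetE.
by rewrite /lift_poly psubst_pvar.
Qed.

Lemma restr_sum_xset (Q : pred {set E}) :
  restr_poly (\sum_(F in P | Q F) xset P F)
  = \sum_(G in pflats N | Q (zlift G)) fxset N G.
Proof.
rewrite rmorph_sum (bigID (fun F : {set E} => Z \subset F)) /=.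
rewrite [X in _ + X]big1 ?addr0; last first.
  by move=> F /andP[/andP[FP _] ZF]; rewrite restr_xset // (negbTE ZF).
under eq_bigl => F do rewrite -andbA [Q F && _]andbC.
rewrite (sum_above Q (fun F => restr_poly (xset P F))).
by apply: eq_bigr => G /andP[GN _]; rewrite restr_xset ?zlift_P // sub_zlift preim_zlift.
Qed.

Lemma sum_zlift (V : zmodType) (g : {set EZ} -> V) i : i \in Z ->
  \sum_(G in pflats N | i \in zlift G) g G = \sum_(G in pflats N) g G.
Proof.
by move=> iZ; apply: eq_bigl => G; rewrite (subsetP (sub_zlift G)) ?andbT.
Qed.

(** [insubd j0] sends all of [Z] to [j0]. For [i] in [Z] every [zlift G] contains [i], and
    [normal_class] makes up the difference to the linear form of [j0]. *)
Lemma restr_lin i : restr_poly (chow_lin P i) = fchow_lin N (insubd j0 i).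
Proof.
rewrite /chow_lin rmorphD /= restr_xelt restr_sum_xset /insubd.
case: insubP => [j jZ <-|].
  rewrite (negbTE (valP j)) add0r; apply: eq_bigl => G.
  by rewrite zlift_mem.
by rewrite negbK => iZ; rewrite /= iZ sum_zlift // /normal_class addrNK.
Qed.

Lemma restr_ideal f :
  f \in ideal_gen (chow_rel M P) -> qpi (fchow_rel N) (restr_poly f) = 0.
Proof.
move=> fI; rewrite -[LHS]mul1r.
pose g : {rmorphism _ -> _} := qpi (fchow_rel N) \o restr_poly.
apply: (rmorph_ideal0 (g := g)) fI => {}f; rewrite mul1r /=.
case=> [F1 F2 F1P F2P F12 F21|i F FP iF|I indI clI|i j ij].
- rewrite rmorphM /= !restr_xset //.
  have [ZF1|_] := ifPn; last by rewrite mul0r rmorph0.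
  have [ZF2|_] := ifPn; last by rewrite mulr0 rmorph0.
  apply/qpi_rel/FChowIncomparable; rewrite -?mem_P_above //.
    by rewrite -zliftS !zlift_preim.
  by rewrite -zliftS !zlift_preim.
- rewrite rmorphM /= restr_xelt restr_xset //.
  have [iZ|_] := ifPn; last by rewrite mul0r rmorph0.
  have [ZF|_] := ifPn; last by rewrite mulr0 rmorph0.
  by rewrite (subsetP ZF) in iF.
- have [j jI jZ] := spanning_meets clI.
  by rewrite rmorph_prod (bigD1 j) //= restr_xelt (negbTE jZ) mul0r rmorph0.
- rewrite rmorphB /= !restr_lin.
  have [->|nij] := eqVneq (insubd j0 i) (insubd j0 j); first by rewrite subrr rmorph0.
  exact/qpi_rel/FChowLinear.
Qed.

Section Annihilator.
(* The two cases of interest are [t = x_I] in [A(M, P)] and [t = x_Z] in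
   [A(M, P+)]. *)
Variables (R : comPzRingType) (theta : {rmorphism chow_poly P -> R}) (t : R).
Hypothesis theta_ideal : forall f, chow_rel M P f -> theta f = 0.
Hypothesis t_xset : forall F : {set E}, F \in P -> ~~ (Z \subset F) ->
  t * theta (xset P F) = 0.
Hypothesis t_xelt : forall j, j \notin Z -> t * theta (xelt P j) = 0.

Lemma theta_lin i j : theta (chow_lin P i) = theta (chow_lin P j).
Proof.
have [->//|ij] := eqVneq i j.
by apply/eqP; rewrite -subr_eq0 -rmorphB theta_ideal //; apply: ChowLinear.
Qed.

Lemma supported_sum_xset (Q : pred {set E}) :
  t * theta (\sum_(F in P | Q F) xset P F)
  = t * theta (lift_poly (\sum_(G in pflats N | Q (zlift G)) fxset N G)).
Proof.
rewrite [lift_poly _]rmorph_sum !rmorph_sum /= !mulr_sumr.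
rewrite (bigID (fun F : {set E} => Z \subset F)) /=.
rewrite [X in _ + X]big1 ?addr0; last first.
  by move=> F /andP[/andP[FP _] ZF]; rewrite t_xset.
under eq_bigl => F do rewrite -andbA [Q F && _]andbC.
rewrite (sum_above Q (fun F => t * theta (xset P F))).
by apply: eq_bigr => G /andP[GN _]; rewrite lift_fxset.
Qed.

Lemma supported_lin (j : EZ) :
  t * theta (lift_poly (fchow_lin N j)) = t * theta (chow_lin P (val j)).
Proof.
rewrite /chow_lin rmorphD /= mulrDr t_xelt ?(valP j) // add0r supported_sum_xset.
congr (t * theta (lift_poly _)); apply: eq_bigl => G.
by rewrite zlift_mem.
Qed.

(** Multiplication by [t] factors through the restriction. The main case is [x_i] with [i] in [Z]:
    the linear forms of [i] and [j0] agree, [t] leaves in their sums only the flats above [Z], and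
    removing all of these from the form of [i] leaves [x_i]. *)
Lemma supported_restr f : t * theta (lift_poly (restr_poly f)) = t * theta f.
Proof.
pose g : {rmorphism _ -> _} := theta \o lift_poly \o restr_poly.
apply: (mul_rmorph_eq (g := g)) => -[i|[F FP]] /=; rewrite /restr_poly psubst_pvar /=.
  case: ifP => [iZ|iZ]; last by rewrite !rmorph0 mulr0 t_xelt ?iZ.
  rewrite /normal_class !rmorphB mulrBr /= supported_lin (theta_lin _ i).
  rewrite /chow_lin rmorphD /= mulrDr supported_sum_xset.
  by rewrite /= sum_zlift // addrK.
rewrite -[pvar _]/(pvar (inr (exist _ F FP) : chow_var P)) -xsetE /=.
case: ifP => ZF; last by rewrite !rmorph0 mulr0 t_xset ?ZF.
by rewrite lift_fxset -?mem_P_above // zlift_preim.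
Qed.

(** With [supported_restr], multiplication by [t] becomes a map defined on [A(M_Z)]: [t] kills the
    terms that the lifted linear forms lack. *)
Lemma supported_ideal f : f \in ideal_gen (fchow_rel N) ->
  t * theta (lift_poly f) = 0.
Proof.
move=> fI; pose g : {rmorphism _ -> _} := theta \o lift_poly.
apply: (rmorph_ideal0 (g := g)) fI => {}f /=.
case=> [G1 G2 G1f G2f G12 G21|i j ij].
  rewrite rmorphM /= !lift_fxset // theta_ideal ?mulr0 //.
  by apply: ChowIncomparable; rewrite ?zlift_P ?zliftS.
by rewrite !rmorphB mulrBr /= !supported_lin (theta_lin _ (val j)) subrr.
Qed.

End Annihilator.

End Restriction.

(** * Injectivity *)

Section BasisClass.
Variables (E : finType) (M : matroid E) (P : {set {set E}}) (Z : {set E}).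
Hypotheses (hP : order_filter M P) (hZ : max_outside M P Z).
Implicit Types (F I J : {set E}).
Local Notation pi := (qpi (chow_rel M P)).

Definition xprod I : chow_poly P := \prod_(i in I) xelt P i.

Lemma xprod_xset I F : F \in P -> ~~ (I \subset F) -> pi (xprod I) * pi (xset P F) = 0.
Proof.
move=> FP /subsetPn[i iI iF]; rewrite -rmorphM /xprod (bigD1 i) //= mulrAC.
by rewrite rmorphM /= qpi_rel ?mul0r //; apply: ChowNotin.
Qed.

Lemma basis_sub_flat I F : mbasis M Z I -> F \in P -> I \subset F -> Z \subset F.
Proof.
move=> bI FP IF; rewrite -(closure_basis (Z_flat hZ) bI) -(eqP (P_flat hP FP)).
exact: closure_mono.
Qed.

Lemma basis_xset I F : mbasis M Z I -> F \in P -> ~~ (Z \subset F) ->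
  pi (xprod I) * pi (xset P F) = 0.
Proof.
by move=> bI FP ZF; apply: xprod_xset => //; apply: contra ZF; apply: basis_sub_flat.
Qed.

(** Adding [j] to [I] gives an independent set whose closure lies strictly above [Z], hence a
    product relation. *)
Lemma basis_xelt I j : mbasis M Z I -> j \notin Z -> pi (xprod I) * pi (xelt P j) = 0.
Proof.
move=> bI jZ; have /and3P[IZ indI _] := bI.
have clI := closure_basis (Z_flat hZ) bI.
have jI : j \notin I by apply: contra jZ; apply: (subsetP IZ).
rewrite -rmorphM mulrC /xprod -big_setU1 //=; apply/qpi_rel/ChowIndep.
  by apply: indepU1 => //; rewrite clI.
by apply: (closureU1_in hZ) => //; rewrite clI.
Qed.

(** Next to [x_J], the variable [x_k] equals its linear form minus the sum of the [x_F] with [Z] in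
    [F], because a flat that contains [k] and [J] contains a basis of [Z]. This expression is the
    same for [i] and [j]. *)
Lemma xprod_exchange J i j : i \notin J -> j \notin J ->
  mbasis M Z (i |: J) -> mbasis M Z (j |: J) ->
  pi (xprod (i |: J)) = pi (xprod (j |: J)).
Proof.
have xprodE k : k \notin J -> mbasis M Z (k |: J) -> pi (xprod (k |: J))
    = pi (xprod J) * (pi (chow_lin P k)
      - \sum_(F in P | Z \subset F) pi (xset P F)).
  move=> kJ bk; rewrite /chow_lin rmorphD rmorph_sum /=.
  rewrite (bigID (fun F : {set E} => Z \subset F)) /=.
  have kZ : k \in Z by have /and3P[/subsetP -> //] := bk; rewrite setU11.
  rewrite (eq_bigl (fun F : {set E} => (F \in P) && (Z \subset F))); last first.
    move=> F; rewrite -andbA; congr (_ && _).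
    by case ZF: (Z \subset F); rewrite ?andbF ?andbT ?(subsetP ZF).
  rewrite addrA addrAC addrK mulrDr mulr_sumr [X in _ + X]big1 ?addr0.
    by rewrite -rmorphM mulrC /xprod big_setU1.
  move=> F /andP[/andP[FP kF] ZF]; apply: xprod_xset => //.
  apply: contra ZF => JF; apply: basis_sub_flat bk FP _.
  by rewrite subUset sub1set kF.
move=> iJ jJ bi bj; rewrite !xprodE //; congr (_ * (_ - _)).
have [->//|nij] := eqVneq i j.
by apply/eqP; rewrite -subr_eq0 -rmorphB /= qpi_rel //; apply: ChowLinear.
Qed.

(** Exchange, by induction on the number of elements of [I] outside [J]. It lets one fixed [I] serve
    the product relations of all bases of [Z]. *)
Lemma xprod_basis I J : mbasis M Z I -> mbasis M Z J -> pi (xprod I) = pi (xprod J).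
Proof.
move Dn: #|I :\: J| => n; elim: n I Dn => [|n IH] I Dn bI bJ.
  have IJ : I \subset J by rewrite -setD_eq0 -cards_eq0 Dn.
  congr (pi (xprod _)); apply/eqP.
  by rewrite eqEcard IJ (basis_card bI) (basis_card bJ) leqnn.
have [I0|[i iIJ]] := set_0Vmem (I :\: J); first by rewrite I0 cards0 in Dn.
have [j jJI bK] := basis_exchange bI bJ iIJ.
move: (iIJ) (jJI); rewrite !inE => /andP[iJ iI] /andP[jI jJ].
rewrite -{1}(setD1K iI) (@xprod_exchange _ i j) ?setD1K //
  ?setD11 ?inE ?(negbTE jI) ?andbF //.
apply: IH => //; apply/eqP; rewrite -eqSS -Dn (cardsD1 i (I :\: J)) iIJ add1n eqSS.
apply/eqP; congr #|pred_of_set _|; apply/setP => k; rewrite !inE.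
by have [->|] := eqVneq k j; rewrite ?jJ ?(negbTE jI) ?andbF //= andbCA.
Qed.

End BasisClass.

Section Nontrivial.
Variables (E : finType) (N : matroid E).

(* [{poly _}] is only defined over nontrivial rings. *)
Fact fchow_nonzero : (1 : fchow N) != 0.
Proof.
rewrite -[1]/(qpi (fchow_rel N) 1) qpi_eq0; apply/negP => /ideal_genP[s sG].
(* The constant term of [1] is 1, while every relation has constant term 0. *)
move=> /(congr1 (mcoeff 0%MM)); rewrite mcoeff1 eqxx rmorph_sum /= big_seq big1 //.
have x0 F : (fxset N F)@_0%MM = 0.
  by rewrite /fxset; case: insub => [G|]; rewrite ?mcoeff0 // mcoeffX mnm1_eq0.
move=> c /sG []; last move=> i j _.
  by move=> F1 F2 *; rewrite rmorphM /= rmorphM /= x0 mul0r mulr0.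
rewrite rmorphM rmorphB /= /fchow_lin !rmorph_sum /= !big1 ?subrr ?mulr0 //.
Qed.

HB.instance Definition _ :=
  GRing.PzSemiRing_isNonZero.Build (quotring (fchow_rel N)) fchow_nonzero.
HB.instance Definition _ := GRing.ComNzRing.on (fchow N).

End Nontrivial.

(** The power on the right is monic of degree [d] up to sign, so a nonzero [h] would push the degree
    to at least [d], above that of the left side. The [c i] are then read off as coefficients. *)
Lemma low_degree_multiple (R : comNzRingType) (d : nat) (a b : R)
    (c : 'I_d.-1 -> R) (h : {poly R}) : (0 < d)%N ->
    a%:P + \sum_(i < d.-1) (c i)%:P * 'X^(i.+1) = h * (b%:P - 'X) ^+ d ->
  h = 0 /\ forall i, c i = 0.
Proof.
move=> d0; set q := _ + _ => qE.
have size_q : (size q <= d)%N.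
  apply: leq_trans (size_polyD _ _) _; rewrite geq_max size_polyC.
  rewrite (leq_trans (leq_b1 _)) //=; apply: leq_trans (size_sum _ _ _) _.
  apply/bigmax_leqP => i _; apply: leq_trans (size_polyMleq _ _) _.
  have id : (i.+1 < d)%N by rewrite -ltn_predRL ltn_ord.
  by rewrite size_polyXn size_polyC; case: (_ == _); rewrite /= ?add0n ?(ltnW id).
have bE : b%:P - 'X = - ('X - b%:P) by rewrite opprB.
have mon : ('X - b%:P) ^+ d \is monic by rewrite monic_exp // monicXsubC.
have h0 : h = 0.
  apply: contraTeq size_q => hn; rewrite qE bE exprNn mulrA -ltnNge.
  have hn' : h * (-1) ^+ d != 0
    by rewrite mulrC -signr_odd mulr_sign; case: odd; rewrite ?oppr_eq0.
  rewrite size_Mmonic // size_exp_XsubC addnS /= -[leqLHS]add1n leq_add2r.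
  by rewrite lt0n size_poly_eq0.
have q0 : q = 0 by rewrite qE h0 mul0r.
split=> // i; have := congr1 (fun r : {poly R} => r`_i.+1) q0.
rewrite coef0 coefD coefC add0r coef_sum (bigD1 i) //= coefCM coefXn eqxx mulr1.
rewrite big1 ?addr0 // => k ki; rewrite coefCM coefXn eqSS.
by rewrite [_ == _](inj_eq val_inj) eq_sym (negbTE ki) mulr0.
Qed.

(** * The map to the fibre product *)

Section Detection.
Variables (E : finType) (M : matroid E) (P : {set {set E}}) (Z : {set E}).
Hypotheses (hP : order_filter M P) (hZ : max_outside M P Z).
Local Notation EZ := {e : E | e \notin Z}.
Local Notation N := (contract M Z).
Local Notation "P+" := (Z |: P).
Variable (j0 : EZ).
Local Notation pi := (qpi (chow_rel M P)).
Local Notation piN := (qpi (fchow_rel N)).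
Local Notation restr := (@restr_poly E M P Z j0).

(* [x_Z] goes to [xset P Z = 0]. *)
Definition down_var (v : chow_var P+) : chow_poly P :=
  match v with inl i => xelt P i | inr F => xset P (val F) end.

Definition down_poly : chow_poly P+ -> chow_poly P := psubst down_var.
HB.instance Definition _ := GRing.RMorphism.on down_poly.

(** The constant term passes through [down_var], so that the two maps agree over [A(M_Z)]. For [i]
    in [Z] the value is [alpha - X], since [x_i] in [A(M, P+)] is the image of [x_i] under [Phi]
    minus [x_Z]. *)
Definition expand_var (v : chow_var P+) : {poly fchow N} :=
  (piN (restr (down_var v)))%:P +
  match v with
  | inl i => if i \in Z then - 'X else 0
  | inr F => if val F == Z then 'X else 0
  end.

(* [down_poly] and [expand_poly] together map to the fibre product of
   [A(M, P)] and [A(M_Z)[X]] over [A(M_Z)], with [X] the image of [x_Z]. *)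
Definition expand_poly : chow_poly P+ -> {poly fchow N} := peval expand_var.
HB.instance Definition _ := GRing.RMorphism.on expand_poly.

Lemma xset_Z : xset P Z = 0.
Proof. by rewrite /xset insubN // (Z_notin hZ). Qed.

Lemma down_xelt i : down_poly (xelt P+ i) = xelt P i.
Proof. by rewrite /down_poly psubst_pvar. Qed.

Lemma down_xset (F : {set E}) : F \in P+ -> down_poly (xset P+ F) = xset P F.
Proof.
move=> FP; rewrite -[F in LHS]/(val (exist (fun F => F \in P+) F FP)) xsetE.
by rewrite /down_poly psubst_pvar.
Qed.

Lemma expand_xelt i : expand_poly (xelt P+ i)
  = (piN (restr (xelt P i)))%:P - (if i \in Z then 'X else 0).
Proof. by rewrite /expand_poly peval_pvar /expand_var; case: ifP; rewrite ?oppr0. Qed.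

Lemma expand_xset (F : {set E}) : F \in P+ -> expand_poly (xset P+ F)
  = (piN (restr (xset P F)))%:P + (if F == Z then 'X else 0).
Proof.
move=> FP; rewrite -[F in LHS]/(val (exist (fun F => F \in P+) F FP)) xsetE.
by rewrite /expand_poly peval_pvar.
Qed.

Lemma expand_coef0 g : (expand_poly g)`_0 = piN (restr (down_poly g)).
Proof.
pose ev0 : {rmorphism _ -> _} := horner_eval (0 : fchow N) \o expand_poly.
pose q : {rmorphism _ -> _} := piN \o restr \o down_poly.
rewrite -horner_coef0; apply: (rmorph_eq (g := ev0) (h := q)) => v /=.
rewrite /expand_poly peval_pvar /down_poly psubst_pvar /expand_var /horner_eval.
rewrite hornerD hornerC; case: v => [i|F]; case: ifP => _;
  by rewrite ?hornerN ?hornerX ?horner0 ?oppr0 addr0.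
Qed.

Lemma down_lin i : down_poly (chow_lin P+ i) = chow_lin P i.
Proof.
rewrite /chow_lin rmorphD /= down_xelt [down_poly _]rmorph_sum /=; congr (_ + _).
rewrite big_mkcondr big_setU1 /= ?(Z_notin hZ) // down_xset ?setU11 // xset_Z.
rewrite if_same add0r -big_mkcondr /=.
by apply: eq_bigr => F /andP[FP _]; rewrite down_xset // setU1r.
Qed.

Lemma expand_lin i : expand_poly (chow_lin P+ i) = (piN (restr (chow_lin P i)))%:P.
Proof.
rewrite /chow_lin !rmorphD /= expand_xelt [expand_poly _]rmorph_sum /=.
rewrite big_mkcondr big_setU1 /= ?(Z_notin hZ) // expand_xset ?setU11 // xset_Z eqxx.
rewrite !rmorph0 add0r -big_mkcondr addrA /= addrNK.
rewrite [restr (\sum_(_ in _ | _) _)]rmorph_sum !rmorph_sum /=; congr (_ + _).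
apply: eq_bigr => F /andP[FP _]; rewrite expand_xset ?setU1r //.
by case: eqP FP => [->|]; rewrite ?(negbTE (Z_notin hZ)) // addr0.
Qed.

Variable I : {set E}.
Hypothesis bI : mbasis M Z I.
Local Notation d := (M Z).
Local Notation alpha := (piN (normal_class M j0)).

(* [g] maps to a pair [(x_I f(0), f (alpha - X)^d)], where [c] lifts [f(0)]. *)
Definition blowup_rel (g : chow_poly P+) : Prop :=
  exists (f : {poly fchow N}) (c : fchow_poly N), [/\ f`_0 = piN c,
    pi (down_poly g) = pi (xprod P I) * pi (lift_poly P c) &
    expand_poly g = f * (alpha%:P - 'X) ^+ d].

Lemma xprod_supported c : pi (xprod P I) * pi (lift_poly P (restr c))
  = pi (xprod P I) * pi c.
Proof.
apply: (supported_restr hP hZ) => [f|F|j].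
- exact: qpi_rel.
- exact: (basis_xset hP hZ bI).
- exact: (basis_xelt hZ bI).
Qed.

(** A product with [x_I] sees [down_poly g] only through its restriction, which is the constant term
    of [expand_poly g]. *)
Lemma blowup_relM g h : blowup_rel h -> blowup_rel (g * h).
Proof.
case=> f [c [f0 downh exph]]; exists (expand_poly g * f), (restr (down_poly g) * c).
split.
- by rewrite coef0M f0 expand_coef0 -rmorphM.
- rewrite (rmorphM down_poly) (rmorphM pi) /= downh (rmorphM (lift_poly P (Z:=Z))).
  rewrite (rmorphM pi) /=.
  have absorb (R : comPzRingType) (x l a b : R) : x * l = x * a ->
      a * (x * b) = x * (l * b).
    by rewrite mulrCA !mulrA => ->.
  exact/absorb/xprod_supported.
- by rewrite rmorphM /= exph mulrA.
Qed.

Lemma blowup_relD g h : blowup_rel g -> blowup_rel h -> blowup_rel (g + h).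
Proof.
case=> f1 [c1 [f10 down1 exp1]] [f2 [c2 [f20 down2 exp2]]].
exists (f1 + f2), (c1 + c2); split.
- by rewrite coefD f10 f20 rmorphD.
- by rewrite !rmorphD /= down1 down2 mulrDr.
- by rewrite rmorphD /= exp1 exp2 mulrDl.
Qed.

Lemma blowup_rel0 g : pi (down_poly g) = 0 -> expand_poly g = 0 -> blowup_rel g.
Proof.
move=> d0 e0; exists 0, 0; split; first by rewrite coef0 rmorph0.
  by rewrite d0 (rmorph0 (lift_poly P (Z:=Z))) rmorph0 mulr0.
by rewrite mul0r.
Qed.

Lemma expand_notin (j : E) : j \notin Z -> expand_poly (xelt P+ j) = 0.
Proof.
by move=> jZ; rewrite expand_xelt restr_xelt (negbTE jZ) !rmorph0 subr0.
Qed.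

(** Every relation vanishes in both components, except the product over a basis [J] of [Z], whose
    pair is [x_J] and [(alpha - X)^d]. *)
Lemma blowup_rel_rel g : chow_rel M P+ g -> blowup_rel g.
Proof.
have notZ (F : {set E}) : F \in P+ -> F != Z -> F \in P.
  by case/setU1P => [->|//]; rewrite eqxx.
have expP (F : {set E}) :
    F \in P -> expand_poly (xset P+ F) = (piN (restr (xset P F)))%:P.
  move=> FP; rewrite expand_xset ?setU1r //.
  by case: eqP FP => [->|]; rewrite ?(negbTE (Z_notin hZ)) // addr0.
have expPZ (F : {set E}) : F \in P -> ~~ (Z \subset F) -> expand_poly (xset P+ F) = 0.
  by move=> FP ZF; rewrite expP // restr_xset // (negbTE ZF) !rmorph0.
have relN f : chow_rel M P f -> piN (restr f) = 0.
  by move=> rf; apply: (restr_ideal hP hZ); apply: mem_ideal_gen.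
case=> [F1 F2 F1P F2P F12 F21|i F FP iF|J indJ clJ|i j ij].
- have [F1Z|nF1] := eqVneq F1 Z.
    have F2P' : F2 \in P by apply: notZ => //; apply: contraNneq F12 => ->; rewrite F1Z.
    apply: blowup_rel0; first by rewrite rmorphM /= down_xset // F1Z xset_Z mul0r rmorph0.
    by rewrite rmorphM /= (expPZ F2) ?mulr0 // -F1Z.
  have [F2Z|nF2] := eqVneq F2 Z.
    have F1P' : F1 \in P by apply: notZ.
    apply: blowup_rel0.
      by rewrite rmorphM /= (down_xset F2P) F2Z xset_Z mulr0 rmorph0.
    by rewrite rmorphM /= (expPZ F1) ?mul0r // -F2Z.
  have rel : chow_rel M P (xset P F1 * xset P F2).
    by apply: ChowIncomparable => //; apply: notZ.
  apply: blowup_rel0; first by rewrite rmorphM /= !down_xset // qpi_rel.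
  by rewrite (rmorphM expand_poly) /= !expP ?notZ // -polyCM
    -(rmorphM piN) -(rmorphM restr) /= relN.
- have [iZ|iZ] := boolP (i \in Z).
    have FP' : F \in P by apply: notZ => //; apply: contraNneq iF => ->.
    apply: blowup_rel0.
      by rewrite rmorphM /= down_xelt down_xset // qpi_rel //; apply: ChowNotin.
    by rewrite rmorphM /= (expPZ F) ?mulr0 //; apply: contra iF => /subsetP; apply.
  apply: blowup_rel0; last by rewrite rmorphM /= expand_notin // mul0r.
  rewrite rmorphM /= down_xelt down_xset //.
  have [->|nF] := eqVneq F Z; first by rewrite xset_Z mulr0 rmorph0.
  by apply/qpi_rel/ChowNotin => //; apply: notZ.
- have downJ : down_poly (\prod_(i in J) xelt P+ i) = xprod P J.
    by rewrite rmorph_prod; apply: eq_bigr => i _; rewrite /= down_xelt.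
  have [clZ|nclZ] := eqVneq (closure M J) Z.
    (* The witness is [f = 1]; [x_J] and [x_I] agree by [xprod_basis]. *)
    have bJ := basis_closure indJ clZ; exists 1, 1; split.
    + by rewrite coef1 eqxx rmorph1.
    + by rewrite downJ !rmorph1 mulr1; apply: (xprod_basis hP hZ).
    + rewrite mul1r rmorph_prod /= -(basis_card bJ) -prodr_const.
      apply: eq_bigr => i iJ; have /and3P[/subsetP JZ _ _] := bJ.
      by rewrite expand_xelt restr_xelt JZ.
  have clJ' : closure M J \in setT |: P.
    by case/setU1P: clJ => [->|/notZ clP]; rewrite ?setU11 // setU1r // clP.
  apply: blowup_rel0; first by rewrite downJ; apply/qpi_rel/ChowIndep.
  have [j jJ jZ] := spanning_meets hP hZ clJ'.
  by rewrite rmorph_prod (bigD1 j) //= expand_notin // mul0r.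
- apply: blowup_rel0; rewrite rmorphB /=.
    by rewrite !down_lin qpi_rel //; apply: ChowLinear.
  by rewrite !expand_lin -polyCB -(rmorphB piN) -(rmorphB restr) /= relN //;
     apply: ChowLinear.
Qed.

Lemma blowup_rel_ideal g : g \in ideal_gen (chow_rel M P+) -> blowup_rel g.
Proof.
case/ideal_genP=> s sG ->; rewrite big_seq; elim/big_ind: _ => [|g1 g2|c /sG].
- by apply: blowup_rel0; rewrite !rmorph0.
- exact: blowup_relD.
- by move/blowup_rel_rel; apply: blowup_relM.
Qed.

Lemma down_Phi f : down_poly (Phi_poly Z f) = f.
Proof.
apply: (rmorph_eq (g := down_poly \o @Phi_poly E P Z) (h := idfun)) => -[i|[F FP]] /=.
  rewrite Phi_xelt; case: ifP => _; rewrite ?rmorphD /= down_xelt //.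
  by rewrite down_xset ?setU11 // xset_Z addr0.
rewrite -[pvar _]/(pvar (inr (exist _ F FP) : chow_var P)) -xsetE /=.
by rewrite Phi_xset // down_xset // setU1r.
Qed.

(** The two terms in ['X] cancel in [x_i + x_Z], so the image of [Phi] is constant in ['X]. *)
Lemma expand_Phi f : expand_poly (Phi_poly Z f) = (piN (restr f))%:P.
Proof.
pose q : {rmorphism _ -> _} := @polyC (fchow N) \o (piN \o restr).
apply: (rmorph_eq (g := expand_poly \o @Phi_poly E P Z) (h := q)) => -[i|[F FP]] /=.
  rewrite Phi_xelt; case: ifP => iZ; rewrite ?rmorphD /= expand_xelt iZ ?subr0 //.
  by rewrite expand_xset ?setU11 // xset_Z eqxx !rmorph0 add0r addrNK.
rewrite -[pvar _]/(pvar (inr (exist _ F FP) : chow_var P)) -xsetE /=.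
rewrite Phi_xset // expand_xset ?setU1r //.
by case: eqP FP => [->|]; rewrite ?(negbTE (Z_notin hZ)) // addr0.
Qed.

Lemma expand_Psi p c : expand_poly (@Psi_poly E M P Z p c) = (piN c)%:P * 'X^p.
Proof.
rewrite /Psi_poly rmorphM rmorphXn /= expand_xset ?setU11 // xset_Z eqxx.
rewrite !rmorph0 add0r mulrC; congr (_ * _).
pose q : {rmorphism _ -> _} := @polyC (fchow N) \o piN.
pose s : {rmorphism _ -> _} := psubst (@Psi_var E M P Z).
apply: (rmorph_eq (g := expand_poly \o s) (h := q)) => -[G GN] /=.
rewrite /s /= psubst_pvar /Psi_var /=.
have GP : zlift G \in P by rewrite (zlift_P hP hZ).
rewrite expand_xset ?setU1r // restr_xset // sub_zlift preim_zlift.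
rewrite -[pvar _]/(pvar (exist _ G GN : fchow_var N)) -fxsetE /=.
by case: eqP GP => [->|]; rewrite ?(negbTE (Z_notin hZ)) // addr0.
Qed.

Lemma down_Psi p c : (0 < p)%N -> down_poly (@Psi_poly E M P Z p c) = 0.
Proof.
case: p => // p _; rewrite /Psi_poly exprS -mulrA rmorphM /=.
by rewrite down_xset ?setU11 // xset_Z mul0r.
Qed.

(** The expansion has degree below [d] in ['X], so the factor [h] in front of [(alpha - X)^d] is
    zero, and with it the [Psi] components. The [Phi] component is then [x_I] times a lift of
    [h(0) = 0]. *)
Lemma flip_poly_inj f (c : 'I_d.-1 -> fchow_poly N) : (0 < d)%N ->
    Phi_poly Z f + \sum_(i < d.-1) @Psi_poly E M P Z i.+1 (c i)
      \in ideal_gen (chow_rel M P+) ->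
  pi f = 0 /\ forall i, piN (c i) = 0.
Proof.
move=> d0 /blowup_rel_ideal[h [b [h0]]].
rewrite (rmorphD down_poly) (rmorphD expand_poly) /= down_Phi expand_Phi.
rewrite (rmorph_sum down_poly) (rmorph_sum expand_poly) /= big1 ?addr0; last first.
  by move=> i _; rewrite down_Psi.
move=> fE; under eq_bigr => i _ do rewrite expand_Psi.
case/(low_degree_multiple d0) => h0' c0; split=> //.
rewrite fE; apply: (supported_ideal hP hZ) => [g|F|j|].
- exact: qpi_rel.
- exact: (basis_xset hP hZ bI).
- exact: (basis_xelt hZ bI).
- by rewrite -qpi_eq0 -h0 h0' coef0.
Qed.

End Detection.

(** * Surjectivity *)

(** Every term of the expansion except the product of the [F i] contains [t], and next to [t] each
    [F i] may be replaced by [y]. The correction is therefore that of the case where all [F i] are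
    [y]. *)
Lemma prod_shift (R : comPzRingType) (I : finType) (A : {set I}) (t y : R) (F : I -> R) :
    {in A, forall i, t * F i = t * y} ->
  \prod_(i in A) (F i - t) = \prod_(i in A) F i + ((y - t) ^+ #|A| - y ^+ #|A|).
Proof.
rewrite -!big_enum cardE => tA.
have {tA} : {in enum A, forall i, t * F i = t * y}.
  by move=> i; rewrite mem_enum; apply: tA.
elim: (enum A) => [|i s IH] ts; first by rewrite !big_nil subrr addr0.
have tF : t * F i = t * y by rewrite ts ?mem_head.
have {}ts : {in s, forall k, t * F k = t * y} by move=> k ks; rewrite ts // inE ks orbT.
have tprod : t * \prod_(i <- s) F i = t * y ^+ size s.
  elim: s ts {IH} => [|k s IH] ts; first by rewrite big_nil.
  rewrite big_cons mulrCA IH => [|l ls]; last by rewrite ts // inE ls orbT.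
  by rewrite mulrCA mulrA ts ?mem_head // -mulrA -exprS.
have FE : F i * ((y - t) ^+ size s - y ^+ size s)
    = y * ((y - t) ^+ size s - y ^+ size s).
  by rewrite subrXX addrAC subrr add0r !mulNr !mulrN !mulrA ![_ * t]mulrC tF.
rewrite !big_cons (IH ts) /= mulrBl (mulrDr (F i)) (mulrDr t) FE tprod /=.
rewrite !exprS opprD addrACA.
rewrite -addrA; congr (_ + _); rewrite -mulrBl mulrBr addrCA; congr (_ + _).
by rewrite mulrBl opprB addKr.
Qed.

Lemma exprB_ends (R : comPzRingType) (y t : R) n :
  (y - t) ^+ n.+1 = y ^+ n.+1
    + \sum_(i < n) y ^+ (n - i) * (- t) ^+ i.+1 *+ 'C(n.+1, i.+1) + (- t) ^+ n.+1.
Proof.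
rewrite exprDn big_ord_recl big_ord_recr /= subn0 expr0 mulr1 bin0 subnn expr0 mul1r.
by rewrite binn addrA; congr (_ + _ + _); apply: eq_bigr => i _; rewrite subSS.
Qed.

Lemma fxset_homog (E : finType) (N : matroid E) F : fxset N F \is 1.-homog.
Proof. by rewrite /fxset; case: insub => [G|]; rewrite ?rpred0 // dhomogX /= mdeg1. Qed.

Lemma homogz0 n k : homogz k (0 : {mpoly int[n]}).
Proof. by rewrite /homogz msupp0. Qed.

Lemma homogzX n k p (f : {mpoly int[n]}) : homogz k f -> homogz (k *+ p) (f ^+ p).
Proof.
move=> fk; elim: p => [|p IH]; first exact/homogzP/dhomog1.
by rewrite exprS mulrS; apply: homogzM.
Qed.

(** * The image of the flip map *)

Section Spanning.
Variables (E : finType) (M : matroid E) (P : {set {set E}}) (Z : {set E}).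
Hypotheses (hP : order_filter M P) (hZ : max_outside M P Z).
Local Notation EZ := {e : E | e \notin Z}.
Local Notation N := (contract M Z).
Local Notation "P+" := (Z |: P).
Variables (j0 : EZ) (I : {set E}).
Hypothesis bI : mbasis M Z I.
Local Notation d := (M Z).
Local Notation pi := (qpi (chow_rel M P+)).
Local Notation restr := (@restr_poly E M P Z j0).
Local Notation lift := (@lift_poly E M P Z).
Local Notation Phip := (@Phi_poly E P Z).
Local Notation T := (pi (xset P+ Z)).

Lemma restr_homog k f : homogz k f -> homogz k (restr f).
Proof.
apply: homogz_psubst => -[i|F] /=; last by case: ifP => _; rewrite ?rpred0 ?fxset_homog.
case: ifP => _; last exact: rpred0.
by rewrite rpredB // rpred_sum // => G _; apply: fxset_homog.
Qed.

Lemma Psi_polyE p c : pi (@Psi_poly E M P Z p c) = T ^+ p * pi (Phip (lift c)).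
Proof.
rewrite /Psi_poly (rmorphM pi) (rmorphXn pi) /=; congr (_ * pi _).
apply: (rmorph_eq (g := psubst (@Psi_var E M P Z)) (h := Phip \o lift)) => -[G GN] /=.
have GP : zlift G \in P by rewrite (zlift_P hP hZ).
by rewrite /lift_poly !psubst_pvar /Psi_var /lift_var /= Phi_xset.
Qed.

(** The class [x_Z] kills [x_j] for [j] outside [Z], and also [x_F] for [F] in [P] not above [Z],
    which is incomparable to [Z]. *)
Lemma T_restr f : T * pi (Phip (lift (restr f))) = T * pi (Phip f).
Proof.
apply: (supported_restr hP hZ j0 (theta := pi \o Phip)) => [g rg|F FP ZF|j jZ] /=.
- by apply/eqP; rewrite qpi_eq0; apply: (Phi_ideal hP hZ); apply: mem_ideal_gen.
- rewrite Phi_xset // -rmorphM /=; apply/qpi_rel/ChowIncomparable => //.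
  + exact: setU11.
  + exact: setU1r.
  + exact: P_not_sub hP hZ _ FP.
- rewrite Phi_xelt (negbTE jZ) mulrC -rmorphM /=.
  by apply/qpi_rel/ChowNotin => //; apply: setU11.
Qed.

Lemma T_restr_exp p f :
  T ^+ p.+1 * pi (Phip (lift (restr f))) = T ^+ p.+1 * pi (Phip f).
Proof. by rewrite exprSr -(mulrA (T ^+ p)) T_restr mulrA. Qed.

(** The image of the flip map in degree [k], through homogeneous representatives. Here [k] varies,
    so that multiplication by a variable can shift the degree. *)
Definition flip_span (k : int) : {pred chow M P+} := fun z =>
  `[< exists f (c : 'I_d.-1 -> fchow_poly N), [/\ homogz k f,
        forall i : 'I_d.-1, homogz (k - i.+1%:Z) (c i) &
        z = pi (Phip f) + \sum_(i < d.-1) pi (@Psi_poly E M P Z i.+1 (c i))] >].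

Lemma flip_spanP k z : reflect (exists f (c : 'I_d.-1 -> fchow_poly N),
  [/\ homogz k f, forall i : 'I_d.-1, homogz (k - i.+1%:Z) (c i) &
      z = pi (Phip f) + \sum_(i < d.-1) pi (@Psi_poly E M P Z i.+1 (c i))])
  (z \in flip_span k).
Proof. exact: asboolP. Qed.

Fact flip_span_zmod_closed k : zmod_closed (flip_span k).
Proof.
split=> [|y z /flip_spanP[f [b [fk bk ->]]] /flip_spanP[g [c [gk ck ->]]]];
  apply/flip_spanP.
  exists 0, (fun=> 0); split=> [|i|]; rewrite ?homogz0 //.
  rewrite (rmorph0 Phip) (rmorph0 pi) add0r big1 // => i _.
  by rewrite (raddf0 (@Psi_poly E M P Z i.+1)) (rmorph0 pi).
exists (f - g), (fun i => b i - c i); split=> [|i|].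
- exact: homogzB.
- exact: homogzB.
- rewrite (rmorphB Phip) (rmorphB pi) opprD addrACA -sumrB; congr (_ + _).
  by apply: eq_bigr => i _; rewrite (raddfB (@Psi_poly E M P Z i.+1)) (rmorphB pi).
Qed.
HB.instance Definition _ k :=
  GRing.isZmodClosed.Build (chow M P+) (flip_span k) (flip_span_zmod_closed k).

Lemma flip_span_Phi k f : homogz k f -> pi (Phip f) \in flip_span k.
Proof.
move=> fk; apply/flip_spanP; exists f, (fun=> 0); split=> [//|i|]; rewrite ?homogz0 //.
rewrite big1 ?addr0 // => i _.
by rewrite (raddf0 (@Psi_poly E M P Z i.+1)) (rmorph0 pi).
Qed.

Lemma flip_span_lt k p c : (0 < p < d)%N -> homogz (k - p%:Z) c ->
  T ^+ p * pi (Phip (lift c)) \in flip_span k.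
Proof.
case: p => // p /= pd ck; have pd' : (p < d.-1)%N by rewrite -ltnS (ltn_predK pd).
(* The ordinal [p] stands for the exponent [p.+1]. *)
apply/flip_spanP; exists 0, (fun i => if i == Ordinal pd' then c else 0).
split=> [|i|]; first exact: homogz0.
  by case: eqP => [->//|_]; apply: homogz0.
rewrite (rmorph0 Phip) (rmorph0 pi) add0r (bigD1 (Ordinal pd')) //= eqxx Psi_polyE.
rewrite big1 ?addr0 // => i /negbTE->.
by rewrite (raddf0 (@Psi_poly E M P Z i.+1)) (rmorph0 pi).
Qed.

Lemma normal_homog : homogz 1 (normal_class M j0).
Proof.
apply/homogzP => /=; rewrite /normal_class rpredB // rpred_sum // => G _;
  exact: fxset_homog.
Qed.

Lemma xprod_homog (J : {set E}) : homogz #|J|%:Z (xprod P J).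
Proof.
apply/homogzP; rewrite /xprod -sum1_card.
elim/big_rec2: _ => [|i f n _ IH]; first exact: dhomog1.
by apply: dhomogM => //; apply: xelt_homog.
Qed.

Lemma lift_homog k f : homogz k f -> homogz k (lift f).
Proof. by apply: homogz_psubst => G; apply: xset_homog. Qed.

Hypothesis d_gt0 : (0 < d)%N.

(* [\prod_(i in I) (x_i - T) = 0] in [A(M, P+)], where the [x_i] come from
   [A(M, P)] and have the same product with [T]: this expresses [T ^+ d] through
   lower powers of [T]. *)
Lemma flip_span_top k c : homogz (k - d%:Z) c ->
  T ^+ d * pi (Phip (lift c)) \in flip_span k.
Proof.
move=> ck; have /and3P[/subsetP IZ indI _] := bI.
pose y := pi (Phip (lift (normal_class M j0))).
have Ty i : i \in I -> T * pi (Phip (xelt P i)) = T * y.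
  by move=> /IZ iZ; have := T_restr (xelt P i); rewrite restr_xelt iZ => <-.
have prod0 : pi (\prod_(i in I) xelt P+ i) = 0.
  by apply/qpi_rel/ChowIndep => //; rewrite (closure_basis (Z_flat hZ) bI) !inE eqxx orbT.
have prodE : pi (\prod_(i in I) xelt P+ i) = \prod_(i in I) (pi (Phip (xelt P i)) - T).
  rewrite (rmorph_prod pi); apply: eq_bigr => i /IZ iZ /=.
  by rewrite Phi_xelt iZ (rmorphD pi) addrK.
move: prod0; rewrite prodE (prod_shift (y := y)) // (basis_card bI).
have -> : \prod_(i in I) pi (Phip (xelt P i)) = pi (Phip (xprod P I)).
  by rewrite /xprod (rmorph_prod Phip) (rmorph_prod pi).
have := exprB_ends y T d.-1; rewrite (prednK d_gt0) => ->.
(* The term [y ^+ d] cancels; what remains is solved for [(- T) ^+ d]. *)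
rewrite -[_ + _ + (- T) ^+ d]addrA [y ^+ d + _]addrC addrK addrA.
move/eqP; rewrite addr_eq0 => /eqP topE.
have yE m : y ^+ m * pi (Phip (lift c)) = pi (Phip (lift (normal_class M j0 ^+ m * c))).
  by rewrite (rmorphM lift) (rmorphM Phip) (rmorphM pi)
    !(rmorphXn lift) (rmorphXn Phip) (rmorphXn pi).
rewrite -(rpredMsign _ d) mulrA -exprNn -[X in X * _]opprK -topE mulNr rpredN mulrDl.
apply: rpredD.
  rewrite -(rmorphM pi) -(rmorphM Phip); apply: flip_span_Phi.
  rewrite -[k](subrK d%:Z) addrC -{1}(basis_card bI).
  by apply: homogzM; [exact: xprod_homog | exact: lift_homog].
rewrite mulr_suml; apply: rpred_sum => i _; rewrite mulrnAl rpredMn //.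
have id : (i.+1 < d)%N by rewrite -ltn_predRL ltn_ord.
rewrite exprNn mulrCA -mulrA rpredMsign mulrAC yE mulrC.
apply: flip_span_lt; rewrite ?id //.
(* The power [d.-1 - i] of the normal class raises the degree [k - d] of [c] to [k - i.+1]. *)
have -> : k - i.+1%:Z = 1 *+ (d.-1 - i) + (k - d%:Z).
  have dE : d%:Z = (d.-1 - i)%:Z + i.+1%:Z.
    by rewrite -PoszD addnS subnK ?prednK // ltnW // ltn_ord.
  by rewrite natz dE opprD addrCA addNKr.
by apply: homogzM ck; apply: homogzX; apply: normal_homog.
Qed.

Lemma flip_span_le k p c : (0 < p <= d)%N -> homogz (k - p%:Z) c ->
  T ^+ p * pi (Phip (lift c)) \in flip_span k.
Proof.
rewrite [(p <= d)%N]leq_eqVlt andb_orr => /orP[/andP[_ /eqP->]|];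
  last exact: flip_span_lt.
exact: flip_span_top.
Qed.

Lemma flip_spanM k l w z :
    (forall f, homogz k f -> w * pi (Phip f) \in flip_span (l + k)) ->
    (forall i c, (i < d.-1)%N -> homogz (k - i.+1%:Z) c ->
       w * (T ^+ i.+1 * pi (Phip (lift c))) \in flip_span (l + k)) ->
  z \in flip_span k -> w * z \in flip_span (l + k).
Proof.
move=> wPhi wPsi /flip_spanP[f [c [fk ck ->]]].
rewrite mulrDr rpredD ?wPhi // mulr_sumr rpred_sum // => i _.
by rewrite Psi_polyE wPsi.
Qed.

(** On a [Psi] component, [g] is absorbed by restricting its product with the lift of [c]; the
    exponent of [T] stays the same. *)
Lemma flip_spanM_Phi k l g z : homogz l g -> z \in flip_span k ->
  pi (Phip g) * z \in flip_span (l + k).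
Proof.
move=> gl; apply: flip_spanM => [f fk|i c id ck].
  by rewrite -(rmorphM pi) -(rmorphM Phip) flip_span_Phi // homogzM.
rewrite mulrCA -(rmorphM pi) -(rmorphM Phip) /= -T_restr_exp.
apply: flip_span_lt; first by rewrite -ltn_predRL.
by rewrite -addrA; apply/restr_homog/homogzM => //; apply: lift_homog.
Qed.

(** The exponent of [T] rises by one, from 0 on the [Phi] component. It may reach [d], where
    [flip_span_top] applies. *)
Lemma flip_spanM_T k z : z \in flip_span k -> T * z \in flip_span (1 + k).
Proof.
apply: flip_spanM => [f fk|i c id ck].
  rewrite -[T]expr1 -T_restr_exp; apply: flip_span_le; first exact: d_gt0.
  by rewrite addrC addKr; apply: restr_homog.
rewrite mulrA -exprS; apply: flip_span_le; first by rewrite -ltn_predRL.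
by rewrite -[i.+2]add1n PoszD opprD addrACA subrr add0r.
Qed.

Lemma flip_spanM_var (v : chow_var P+) k z : z \in flip_span k ->
  pi (pvar v) * z \in flip_span (1 + k).
Proof.
move=> zk; case: v => [i|[F FP]].
  (* For [i] in [Z], the variable [x_i] is the image of [x_i] under [Phi] minus [T]. *)
  have iE : pi (xelt P+ i) = pi (Phip (xelt P i)) - (if i \in Z then T else 0).
    by rewrite Phi_xelt; case: ifP => _; rewrite ?subr0 // (rmorphD pi) addrK.
  rewrite -[pvar _]/(xelt P+ i) iE mulrBl rpredB //.
    by apply: flip_spanM_Phi zk; apply/homogzP/xelt_homog.
  by case: ifP => _; [apply: flip_spanM_T | rewrite mul0r rpred0].
rewrite -[pvar _]/(pvar (inr (exist _ F FP) : chow_var P+)) -xsetE /=.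
case/setU1P: (FP) => [->|FP']; first exact: flip_spanM_T.
rewrite -(Phi_xset Z FP'); apply: flip_spanM_Phi zk.
exact/homogzP/xset_homog.
Qed.

(** The span contains 1 in degree 0 and is stable under every variable, so it contains all
    monomials. *)
Lemma flip_span_full q g : homogz q g -> pi g \in flip_span q.
Proof.
move=> /allP gq; rewrite [g]mpolyE (rmorph_sum pi) big_seq rpred_sum // => m /gq /eqP <-.
rewrite -mul_mpolyC -[_@__]intz rmorph_int mulrzl (rmorphMz pi) rpredMz //.
pose stable w (n : nat) :=
  forall k z, z \in flip_span k -> pi w * z \in flip_span (n%:Z + k).
have stable1 : stable 1 0 by move=> k z zk; rewrite (rmorph1 pi) mul1r add0r.
have stableM a b n p : stable a n -> stable b p -> stable (a * b) (n + p)%N.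
  by move=> sa sb k z zk; rewrite (rmorphM pi) -mulrA PoszD -addrA; apply/sa/sb.
suff : stable 'X_[m] (mdeg m).
  move=> /(_ 0 1); rewrite mulr1 addr0; apply.
  rewrite -(rmorph1 pi) -(rmorph1 Phip); apply: flip_span_Phi.
  by apply/homogzP; apply: dhomog1.
rewrite mpolyXE_id mdegE.
elim/big_ind2: _ => [|a n b p sa sb|i _].
- exact: stable1.
- exact: stableM.
elim: (m i) => [|n IH]; first exact: stable1.
rewrite exprS -add1n; apply: stableM IH => k z.
by rewrite -[i]enum_valK; apply: flip_spanM_var.
Qed.

End Spanning.

(** * Passage to the degree [q] parts *)

Theorem theorem6p18 (E : finType) (M : matroid E) (r : nat)
    (P : {set {set E}}) (Z : {set E}) (q : nat)
    (hM : loopless M) (hr : mrank M [set: E] = r.+1)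
    (hP : order_filter M P) (hZ : max_outside M P Z) (hq : (0 < q)%N) :
  bijective (flip_map hP hZ q : {additive flip_source M P Z q
                                   -> chow_gr M (Z |: P) (Posz q)}).
Proof.
have /subsetPn[j _ jZ] : ~~ (setT \subset Z) by rewrite subTset (Z_neqT hZ).
pose j0 : {e : E | e \notin Z} := exist _ j jZ.
have [I bI] := basis_exists M Z.
(* An element of the nonempty set [Z] has rank 1 because [M] is loopless. *)
have d_gt0 : (0 < M Z)%N.
  have /set0Pn[e eZ] := Z_neq0 hZ.
  have := mrank_mono M (B := Z) (A := [set e]); rewrite sub1set eZ => /(_ isT).
  by apply: leq_trans; have /eqP-> := hM e; rewrite cards1.
have gval_sum (s : 'I_(M Z).-1 -> chow_gr M (Z |: P) q%:Z) :
    gval (\sum_i s i) = \sum_i gval (s i).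
  exact: (raddf_sum (val : chow_gr M (Z |: P) q%:Z -> _)).
have inj : injective (flip_map hP hZ q).
  apply: raddf_inj => -[a c] /(congr1 gval).
  rewrite /flip_map [LHS]/= gval_sum /=.
  have /gradeP[f _ aE] := gvalP a.
  have [g gE] : exists g, forall i, gval (c i) = qpi _ (g i).
    by exists (fun i => repr (gval (c i))) => i; rewrite qpi_repr.
  rewrite aE PhiE; under eq_bigr => i _ do rewrite gE PsiE.
  rewrite -(rmorph_sum (qpi _)) -(rmorphD (qpi _)) => /eqP; rewrite qpi_eq0.
  move=> /(flip_poly_inj hP hZ j0 bI d_gt0)[f0 g0].
  congr (_, _); first by apply: val_inj; rewrite /= aE f0.
  by apply/ffunP => i; apply: val_inj; rewrite ffunE /= gE g0.
have surj y : exists x, flip_map hP hZ q x = y.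
  have /gradeP[h hq' yE] := gvalP y.
  have /flip_spanP[f [c [fq cq gE]]] := flip_span_full hP hZ j0 bI d_gt0 hq'.
  have fG : qpi (chow_rel M P) f \in grade (chow_rel M P) q%:Z by apply/gradeP; exists f.
  have cG i : qpi _ (c i) \in grade (fchow_rel (contract M Z)) (q%:Z - i.+1%:Z).
    by apply/gradeP; exists (c i).
  exists (GPart fG, [ffun i => GPart (cG i)]); apply: val_inj.
  rewrite /flip_map [LHS]/= gval_sum /= yE gE PhiE; congr (_ + _).
  by apply: eq_bigr => i _; rewrite ffunE /= PsiE.
exists (fun y => sval (cid (surj y))) => [x|y]; last by case: cid.
by case: cid => x' /= /inj.
Qed.
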